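(* For all integers $k\geq 4$ one has $2k\leq g_k(\mathbb{E}^3)\leq 3k-2$. Furthermore, $g_3(\mathbb{E}^3)=6$, and if $S\subset\mathbb{E}^3$ is a $3$-diametral point set with $\mathrm{card}(S)=6$, then the diameter graph of $S$ is isomorphic to one of the following eight graphs on six vertices: (1-a) the wheel consisting of a $5$-cycle and a hub vertex joined to all five vertices of the cycle; (1-b) the graph obtained from the wheel (1-a) by deleting one spoke (an edge joining the hub to a vertex of the $5$-cycle); (1-c) the graph obtained from the wheel (1-a) by deleting two spokes whose endpoints on the $5$-cycle are adjacent on the $5$-cycle; (2-a)-(2-e) the five graphs (up to isomorphism) consisting of a complete graph $K_4$ on vertices $a,b,c,d$, two further vertices $u,v$ joined by an edge, and additional edges between $\{u,v\}$ and $\{a,b,c,d\}$ such that the neighbourhoods $N_u$ of $u$ and $N_v$ of $v$ in $\{a,b,c,d\}$ are disjoint and satisfy $(|N_u|,|N_v|)\in\{(0,0),(1,0),(2,0),(1,1),(2,1)\}$.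
   Context: $\mathbb{E}^3$ is Euclidean $3$-space. A finite set $S$ of (distinct) points of positive diameter in $\mathbb{E}^3$ is a $k$-diametral point set if any $k$ distinct points of $S$ include two points whose Euclidean distance equals the diameter of $S$. $g_k(\mathbb{E}^3)$ is the largest cardinality of a $k$-diametral point set in $\mathbb{E}^3$. The diameter graph of a finite set $S$ has vertex set $S$, with two points joined by an edge if and only if their distance equals the diameter of $S$. *)

(* Defs.v *)
From HB Require Import structures.
From mathcomp Require Import all_boot all_order all_algebra.
From mathcomp Require Import finmap reals.

Set Implicit Arguments.
Unset Strict Implicit.
Unset Printing Implicit Defensive.

Import Order.TTheory GRing.Theory Num.Theory.
Local Open Scope ring_scope.

(* The library norm on 'rV[R]_n is the sup norm, hence an explicit Euclidean
   distance. *)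
Definition edist (R : realType) (n : nat) (x y : 'rV[R]_n) : R :=
  Num.sqrt (\sum_(i < n) (x ord0 i - y ord0 i) ^+ 2).

(* The default value 0 of the maxima is harmless: distances are nonnegative. *)
Definition diam (R : realType) (n : nat) (S : {fset 'rV[R]_n}) : R :=
  \big[Num.max/0]_(x <- S) \big[Num.max/0]_(y <- S) edist x y.

Definition diametral (R : realType) (n k : nat) (S : {fset 'rV[R]_n}) : Prop :=
  0 < diam S /\
  forall T : {fset 'rV[R]_n}, fsubset T S -> #|` T| = k ->
    exists x y, [/\ x \in T, y \in T, x != y & edist x y = diam S].

(* [is_g R n k g]: the largest cardinality g_k(E^n) exists and equals [g]. *)
Definition is_g (R : realType) (n k g : nat) : Prop :=
  (exists S : {fset 'rV[R]_n}, diametral k S /\ #|` S| = g) /\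
  (forall S : {fset 'rV[R]_n}, diametral k S -> (#|` S| <= g)%N).

(* Vertices are the elements of S, as the finite type [fset_sub_type S]. The
   condition [x != y] only matters when S has diameter 0. *)
Definition diam_graph (R : realType) (n : nat) (S : {fset 'rV[R]_n}) : rel S :=
  fun x y => (x != y) && (edist (val x) (val y) == diam S).

Definition graph_iso (T T' : finType) (e : rel T) (e' : rel T') : Prop :=
  exists2 f : T -> T', bijective f & forall x y, e' (f x) (f y) = e x y.

(* [ordS] is the cyclic successor on 'I_5. *)
Definition cycle5 : rel 'I_5 := fun i j => (j == ordS i) || (i == ordS j).

(* The wheel with 5-cycle [Some i] and hub [None], from which the spokes to the
   cycle vertices in D have been deleted. *)
Definition wheel5_minus (D : {set 'I_5}) : rel (option 'I_5) := fun x y =>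
  match x, y with
  | Some i, Some j => cycle5 i j
  | None, Some i | Some i, None => i \notin D
  | None, None => false
  end.

(* The vertices [inl i] span a K_4; [inr false] and [inr true] are the adjacent
   vertices u and v, whose neighbourhoods in the K_4 are Nu and Nv. *)
Definition K4_edge (Nu Nv : {set 'I_4}) : rel ('I_4 + bool)%type := fun x y =>
  match x, y with
  | inl i, inl j => i != j
  | inr s, inr t => s != t
  | inl i, inr s | inr s, inl i => i \in (if s then Nv else Nu)
  end.

Definition one_of_eight (T : finType) (e : rel T) : Prop :=
  [\/ graph_iso e (wheel5_minus set0),
      exists i : 'I_5, graph_iso e (wheel5_minus [set i]),
      exists i j : 'I_5, cycle5 i j /\ graph_iso e (wheel5_minus [set i; j])
    | exists Nu Nv : {set 'I_4},
        [/\ [disjoint Nu & Nv],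
            (#|Nu|, #|Nv|) \in
              [:: (0, 0); (1, 0); (2, 0); (1, 1); (2, 1)]%N
          & graph_iso e (K4_edge Nu Nv)]].

(* Main.v *)
(* Let G be the diameter graph of S. For a vertex x let R(x) be the cone of
   directions spanned by the edges leaving x. Cones at distinct vertices x, y are
   separated by y - x, and -R(x) meets R(y) only if the paths spanning the two cones
   share a vertex. An odd circuit C therefore draws, by arcs lying alternately in
   R(c) and -R(c) for c in C, a centrally symmetric closed curve on the sphere, and
   for x off C the cone R(x) lies on one side of it. The two directions of an
   edge are opposite and the antipodal map exchanges the two sides, so the side
   2-colours G - C; this is Dol'nikov's theorem that odd circuits meet.

   Let a be the independence number and C a shortest odd circuit, of length 2m+1.
   If m = 1 then n <= 2a + 3. Otherwise each of the 2m+1 independent m-subsets of C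
   can be enlarged by the vertices of either colour class of G - C that it does
   not dominate, and a vertex off C is dominated by at most m+1 of these subsets;
   averaging over the subsets, together with |G - C| <= 2a, gives n <= 3a + 1.

   For k = 3 and n >= 6 the complement of G has no triangle; unless G contains a
   K_4, the complement is not 2-colourable and its shortest odd circuit is a
   pentagon, hence an induced pentagon of G. Both cases are settled by the absence
   in G of two disjoint triangles and of a K_5 minus an edge. The lower bound comes
   from a regular tetrahedron together with k - 2 diameters of a smaller concentric
   sphere. *)
From mathcomp Require Import all_boot all_order all_algebra.
From mathcomp Require Import finmap reals.
From mathcomp Require boolp.
From mathcomp Require Import topology normedtype realfun.
From mathcomp Require Import ring lra zify.
Require Import Defs.

Set Implicit Arguments.
Unset Strict Implicit.
Unset Printing Implicit Defensive.

(** * Shortest odd circuits *)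

Section Walks.
Variables (V : finType) (e : rel V).
Hypotheses (esym : symmetric e) (eirr : irreflexive e).

Definition bicolorable (W : {set V}) : Prop :=
  exists f : V -> bool, {in W &, forall x y, e x y -> f x != f y}.

Definition independent (A : {set V}) : bool :=
  [forall x in A, forall y in A, ~~ e x y].

Lemma independentP (A : {set V}) :
  reflect {in A &, forall x y, ~~ e x y} (independent A).
Proof.
apply: (iffP forall_inP) => [h x y xA yA | h x xA].
  exact: (forall_inP (h x xA)).
by apply/forall_inP => y yA; exact: h.
Qed.

Fixpoint walk (n : nat) (x y : V) : bool :=
  if n is n'.+1 then [exists z, e x z && walk n' z y] else x == y.

Lemma walk_cons n x y z : e x y -> walk n y z -> walk n.+1 x z.
Proof. by move=> exy w; apply/existsP; exists y; rewrite exy. Qed.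

Lemma walk_cat a b x y z : walk a x y -> walk b y z -> walk (a + b) x z.
Proof.
elim: a x => [|a IH] x /=; first by move=> /eqP->.
by move=> /existsP[u /andP[xu uy]] yz; apply: (walk_cons xu); apply: IH.
Qed.

Lemma walk1 x y : e x y -> walk 1 x y.
Proof. by move=> exy; apply: (walk_cons exy) => /=. Qed.

Lemma walk_sym n x y : walk n x y -> walk n y x.
Proof.
elim: n x => [|n IH] x; first by rewrite /= eq_sym.
move=> /existsP[u /andP[xu uy]]; rewrite -addn1.
by apply: walk_cat (IH _ uy) _; apply: walk1; rewrite esym.
Qed.

Lemma connect_walk x y : connect e x y -> exists n, walk n x y.
Proof.
case/connectP => p; elim: p x => [|z p IH] x /=.
  by move=> _ ->; exists 0 => /=.
by case/andP=> xz pz /(IH _ pz)[n w]; exists n.+1; apply: walk_cons w.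
Qed.

(** A vertex takes the parity of a walk from the root of its component; walks of both parities would
    combine into an odd closed walk. *)
Lemma no_odd_walk_bicolorable :
  (forall n x, walk n x x -> ~~ odd n) -> bicolorable [set: V].
Proof.
move=> noodd.
have csym : connect_sym e by apply: sym_connect_sym.
pose P (r x : V) (b : bool) := exists2 n, walk n r x & odd n = b.
have Puniq r x b b' : P r x b -> P r x b' -> b = b'.
  move=> [n w <-] [n' w' <-].
  have := noodd _ _ (walk_cat w (walk_sym w')).
  by rewrite oddD; case: odd; case: odd.
have Pex x : exists b, P (fingraph.root e x) x b.
  have [n w] : exists n, walk n (fingraph.root e x) x.
    by apply: connect_walk; rewrite csym connect_root.
  by exists (odd n), n.
have [f hf] : exists f : V -> bool, forall x, P (fingraph.root e x) x (f x).
  by have [f hf] := fin_all_exists Pex; exists f.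
exists f => x y _ _ exy.
have rxy : fingraph.root e x = fingraph.root e y by apply/eqP; rewrite (root_connect csym) connect1.
have := hf x; have := hf y; rewrite rxy => py [n w on].
have py' : P (fingraph.root e y) y (~~ f x).
  by exists (n + 1); [apply: walk_cat w (walk1 exy) | rewrite addn1 /= on].
by rewrite (Puniq _ _ _ _ py py'); case: (f x).
Qed.

Lemma walk_fun n x y : walk n x y -> exists c : nat -> V,
  [/\ c 0 = x, c n = y & forall i, i < n -> e (c i) (c i.+1)].
Proof.
elim: n x => [|n IH] x /=; first by move=> /eqP->; exists (fun=> y).
case/existsP => z /andP[xz /IH [c [c0 cn ce]]].
exists (fun i => if i is j.+1 then c j else x); split=> //.
by case=> [|i] lt /=; [rewrite c0 | apply: ce].
Qed.

(* The length is 2m+1; vertices may be repeated. *)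
Definition odd_circuit (m : nat) (c : nat -> V) : Prop :=
  (forall i, e (c i) (c i.+1)) /\ (forall i, c (i + m.*2.+1) = c i).

Lemma periodicE L (c : nat -> V) : (forall i, c (i + L) = c i) ->
  forall i j, i = j %[mod L] -> c i = c j.
Proof.
move=> per.
have h i : c i = c (i %% L).
  rewrite {1}(divn_eq i L) addnC; elim: (i %/ L) => [|q IH]; first by rewrite addn0.
  by rewrite mulSn addnCA addnC per IH.
by move=> i j ij; rewrite h ij -h.
Qed.


(** The circuit is extended periodically to [nat] so that indices shift freely; minimality is over
    closed walks because shortcuts may repeat vertices. *)
Lemma shortest_odd_circuit : bicolorable [set: V] \/
  exists m c, odd_circuit m c /\
    (forall n x, odd n -> walk n x x -> m.*2.+1 <= n).
Proof.
pose Q n := odd n && [exists x, walk n x x].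
have [[n Qn]|nQ] := boolp.EM (exists n, Q n); last first.
  left; apply: no_odd_walk_bicolorable => n x w; apply/negP => on.
  by apply: nQ; exists n; rewrite /Q on; apply/existsP; exists x.
right; have exQ : exists n, Q n by exists n.
case: (ex_minnP exQ) => L /andP[oL /existsP[x w]] Lmin.
have [m Lm] : exists m, L = m.*2.+1.
  by exists L./2; rewrite -[LHS]odd_double_half oL.
have [c [c0 cL ce]] := walk_fun w.
have L0 : 0 < L by rewrite Lm.
exists m, (fun i => c (i %% L)); rewrite /odd_circuit -Lm; split; last first.
  by move=> n' y on wn; apply: Lmin; rewrite /Q on; apply/existsP; exists y.
split=> i; last by rewrite modnDr.
have -> : c (i.+1 %% L) = c (i %% L).+1.
  rewrite -addn1 -modnDml addn1.
  have : i %% L < L by rewrite ltn_mod.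
  rewrite leq_eqVlt => /predU1P[->|h]; last by rewrite modn_small.
  by rewrite modnn c0 cL.
by apply: ce; rewrite ltn_mod.
Qed.

Section ShortestCircuit.
Variables (m : nat) (c : nat -> V).
Hypothesis circ : odd_circuit m c.
Hypothesis cmin : forall n x, odd n -> walk n x x -> m.*2.+1 <= n.
Let L := m.*2.+1.

Lemma circuit_walk n i : walk n (c i) (c (i + n)).
Proof.
elim: n i => [|n IH] i; first by rewrite addn0 /=.
by rewrite addnS -addSn; apply: walk_cons (IH _); case: circ.
Qed.

Lemma circuit_walk_back n i : n <= L -> walk (L - n) (c (i + n)) (c i).
Proof.
move=> nL; have := circuit_walk (L - n) (i + n).
by rewrite -addnA subnKC //; case: circ => _ ->.
Qed.

(** Equality would make the complementary arc, of odd length [L - r.*2], a shorter odd closed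
    walk. *)
Lemma circuit_even_neq i r : 0 < r <= m -> c i != c (i + r.*2).
Proof.
move=> rm; apply/eqP => eqc.
have := @circuit_walk_back r.*2 i; rewrite -eqc.
have rL : r.*2 <= L by rewrite /L; lia.
have oL : odd (L - r.*2) by rewrite oddB //= !odd_double.
by move=> /(_ rL)/(cmin oL); rewrite -/L; lia.
Qed.

Lemma circuit_neq i j : 0 < j < L -> c i != c (i + j).
Proof.
move=> jL; have [oj|ej] := boolP (odd j); last first.
  have -> : j = j./2.*2 by rewrite -[LHS]odd_double_half (negbTE ej).
  by apply: circuit_even_neq; move: jL ej; rewrite /L; lia.
apply/eqP => eqc; have := circuit_walk j i; rewrite -eqc => /(cmin oj).
by rewrite -/L; lia.
Qed.

Lemma circuit_inj i j : c i = c j -> i = j %[mod L].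
Proof.
have per := periodicE circ.2.
wlog ij : i j / i %% L <= j %% L => [th|] eqc.
  by case/orP: (leq_total (i %% L) (j %% L)) => h; [|symmetry]; apply: th.
apply/eqP; rewrite eqn_leq ij /= leqNgt; apply/negP => lt.
have jL : j %% L < L by rewrite ltn_mod.
have /eqP[] : c (i %% L) != c (i %% L + (j %% L - i %% L)).
  by apply: circuit_neq; lia.
by rewrite subnKC // (per _ i) ?modn_mod // (per (j %% L) j) ?modn_mod.
Qed.

(** A chord would close the even arc to an odd walk of length [r.*2 + 1], below [L]. *)
Lemma circuit_even_nadj i r : 0 < r < m -> ~~ e (c i) (c (i + r.*2)).
Proof.
move=> rm; apply/negP => adj; rewrite esym in adj.
have oL : odd (r.*2 + 1) by rewrite oddD odd_double.
by have /(cmin oL) := walk_cat (circuit_walk r.*2 i) (walk1 adj); lia.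
Qed.

(** The detour through [x] replaces an arc of length [r.*2] by one of length 2, keeping the walk
    odd, so minimality forces [r.*2 <= 2]. *)
Lemma circuit_common_adj x i r : 0 < r <= m ->
  e x (c i) -> e x (c (i + r.*2)) -> r = 1.
Proof.
move=> rm x1 x2; rewrite esym in x1.
have rL : r.*2 <= L by rewrite /L; lia.
have oL : odd (1 + (L - r.*2 + 1)) by rewrite !oddD oddB //= !odd_double.
have := walk_cat (walk1 x2) (walk_cat (circuit_walk_back i rL) (walk1 x1)).
by move=> /(cmin oL); rewrite -/L; lia.
Qed.

Definition off_circuit : {set V} := [set x | [forall i : 'I_L, x != c i]].

Lemma off_circuitP x i : x \in off_circuit -> x != c i.
Proof.
rewrite inE => /forallP/(_ (Ordinal (ltn_pmod i (ltn0Sn _)))) /=.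
by rewrite (periodicE circ.2 (j := i)) // modn_mod.
Qed.

Lemma card_off_circuit : #|V| <= #|off_circuit| + L.
Proof.
pose C := [set c i | i : 'I_L].
rewrite -(cardsC C) addnC leq_add //; last first.
  by rewrite (leq_trans (leq_imset_card _ _)) // card_ord.
apply: subset_leq_card; apply/subsetP => x; rewrite !inE => xC.
by apply/forallP => i; apply: contra xC => /eqP->; exact: imset_f.
Qed.

(* Listed in steps of two, the circuit is such that its independent sets of size m
   are the intervals of length m. *)
Let d a := c a.*2.

Lemma double_periodic a b : a = b %[mod L] -> d a = d b.
Proof.
move=> ab; apply: (periodicE circ.2).
by have := congr1 (fun t => (t * 2) %% L) ab; rewrite /= !modnMml !muln2.
Qed.

Definition run (s : nat) : {set V} := [set d (s + r.+1) | r : 'I_m].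

Lemma run_independent s : independent (run s).
Proof.
apply/independentP => _ _ /imsetP[r _ ->] /imsetP[r' _ ->].
wlog rr : r r' / r <= r' => [th|].
  by case/orP: (leq_total r r') => h; [|rewrite esym]; apply: th.
have [->|ne] := eqVneq r r'; first by rewrite eirr.
have lt : r < r' by rewrite ltn_neqAle rr andbT.
have -> : s + r'.+1 = (s + r.+1) + (r' - r) by lia.
rewrite /d [(_ + (_ - _)).*2]doubleD; apply: circuit_even_nadj.
by have := ltn_ord r'; lia.
Qed.

Lemma card_run s : #|run s| = m.
Proof.
rewrite card_in_imset ?card_ord // => r r' _ _ eqd; apply: val_inj => /=.
wlog rr : r r' eqd / r <= r' => [th|].
  by case/orP: (leq_total r r') => h; [|symmetry]; apply: th.
apply/eqP; rewrite eqn_leq rr leqNgt; apply/negP => lt.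
have /eqP[] : c (s + r.+1).*2 != c ((s + r.+1).*2 + (r' - r).*2).
  by apply: circuit_even_neq; have := ltn_ord r'; lia.
rewrite -doubleD; have -> : s + r.+1 + (r' - r) = s + r'.+1 by lia.
exact: eqd.
Qed.

Lemma adj_double x a b : e x (d a) -> e x (d b) ->
  [\/ a = b %[mod L], a.+1 = b %[mod L] | b.+1 = a %[mod L]].
Proof.
(* [r] is the residue of b - a, [L * a - a] standing for - a; one of [r] and [L - r] is at most
   [m]. *)
move=> xa xb; pose r := (b + (L * a - a)) %% L.
have aL : a <= L * a by apply: leq_pmull.
have abr : a + r = b %[mod L].
  by rewrite /r modnDmr addnCA subnKC // mulnC addnC modnMDl.
have rL : r < L by rewrite ltn_mod.
have [rm|mr] := leqP r m.
  case: (posnP r) => [r0|r0]; first by apply: Or31; rewrite -abr r0 addn0.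
  apply: Or32; rewrite -abr (@circuit_common_adj x a.*2 r) ?addn1 ?r0 //.
  by rewrite -doubleD -/(d _) (double_periodic abr).
have bar : b + (L - r) = a %[mod L].
  by rewrite -modnDml -abr modnDml -addnA subnKC ?modnDr // ltnW.
apply: Or33; rewrite -bar (@circuit_common_adj x b.*2 (L - r)) ?addn1 //.
  by move: rL mr; clear; rewrite /L; lia.
by rewrite -doubleD -/(d _) (double_periodic bar).
Qed.

(** Three neighbours consecutive in the order [d] would include two at offset 2, excluded by
    [circuit_common_adj] when 1 < m. *)
Lemma adj_double_pair x : 1 < m -> exists j, forall a, e x (d a) ->
  a = j %[mod L] \/ a = j.+1 %[mod L].
Proof.
move=> m1.
have [[a /andP[xa xa1]]|none] := boolp.EM (exists a, e x (d a) && e x (d a.+1)).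
  exists a => b xb; case: (adj_double xb xa) => [->||->]; [by left| |by right].
  move=> ba; have xb2 : e x (d (b + 2)).
    rewrite (@double_periodic _ a.+1) //.
    by rewrite -[a.+1]addn1 -[RHS]modnDml -ba modnDml addn1 addn2.
  rewrite /d doubleD in xb2.
  by have /(_ m1 xb xb2) := @circuit_common_adj x b.*2 2.
have [[a xa]|none'] := boolp.EM (exists a, e x (d a)); last first.
  by exists 0 => a xa; case: none'; exists a.
exists a => b xb; case: (adj_double xb xa) => [->|ba|ab]; first by left.
  by case: none; exists b; rewrite xb /= (double_periodic ba).
by case: none; exists a; rewrite xa (double_periodic ab).
Qed.

(** The run of [s] occupies the indices s + 1, ..., s + m, so it meets {j, j + 1} only if s = j - r
    modulo [L] with 0 <= r <= m. *)
Lemma run_incidence x : 1 < m ->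
  #|[set s : 'I_L | [exists y in run s, e x y]]| <= m.+1.
Proof.
move=> m1; have [j hj] := adj_double_pair x m1.
pose g (r : 'I_m.+1) : 'I_L := inord ((j + (L - r)) %% L).
have gE r : g r = (j + (L - r)) %% L :> nat by rewrite inordK // ltn_mod.
rewrite -[X in _ <= X]card_ord.
apply: (@leq_trans #|g @: 'I_m.+1|); last exact: leq_imset_card.
apply/subset_leq_card/subsetP => s.
rewrite inE => /exists_inP[_ /imsetP[r _ ->]] /hj h.
have rm := ltn_ord r.
have [r' r'm sr] : exists2 r', r' < m.+1 & s + r' = j %[mod L].
  case: h => h; first by exists r.+1.
  exists (nat_of_ord r); first exact: ltnW.
  by apply/eqP; rewrite -(eqn_modDr 1) -addnA !addn1; apply/eqP.
apply/imsetP; exists (Ordinal r'm) => //; apply: ord_inj.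
rewrite gE /= -modnDml -sr modnDml -addnA subnKC; last by move: r'm; clear; rewrite /L; lia.
by rewrite modnDr modn_small.
Qed.

End ShortestCircuit.

(** * Colour classes against the independence number *)

Section Colouring.
Variables (W I : {set V}) (a : nat).
Hypothesis alpha : forall A : {set V}, independent A -> #|A| <= a.

Lemma bicolorable_card : bicolorable W -> #|W| <= a.*2.
Proof.
case=> f hf; pose A b := [set x in W | f x == b].
have hA b : #|A b| <= a.
  apply: alpha; apply/independentP => x y; rewrite !inE.
  move=> /andP[xW /eqP fx] /andP[yW /eqP fy]; apply/negP => /(hf _ _ xW yW).
  by rewrite fx fy eqxx.
have -> : W = A true :|: A false.
  by apply/setP => x; rewrite !inE -andb_orr; case: (f x); rewrite andbT.
by rewrite -addnn (leq_trans (leq_card_setU _ _)) // leq_add.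
Qed.

(** [I] together with the undominated vertices of one colour in [W] is independent; the bounds for
    both colours are added. *)
Lemma bicolorable_card_independent : bicolorable W -> independent I ->
  [disjoint I & W] -> #|I|.*2 + #|W| <= a.*2 + #|[set x in W | [exists y in I, e x y]]|.
Proof.
case=> f hf /independentP Iind IW.
pose N := [set x in W | [exists y in I, e x y]].
pose A b := [set x in W :\: N | f x == b].
have hA b : #|I| + #|A b| <= a.
  have /setDidPl dIA : [disjoint I & A b].
    apply: disjointWr IW; apply/subsetP => x; rewrite !inE.
    by case/andP => /andP[].
  have <- : #|I :|: A b| = #|I| + #|A b|.
    rewrite cardsU (_ : I :&: A b = set0) ?cards0 ?subn0 //.
    by apply/eqP; rewrite setI_eq0; apply/setDidPl.
  have IA x y : x \in I -> y \in A b -> ~~ e y x.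
    move=> xI; rewrite !inE negb_and => /andP[/andP[/orP[/negPf->//|h] _] _].
    by apply: contra h => yx; apply/exists_inP; exists x.
  apply: alpha; apply/independentP => x y; rewrite !in_setU.
  case/orP=> xA /orP[yA|yA].
  - exact: Iind.
  - by rewrite esym IA.
  - by rewrite IA.
  move: xA yA; rewrite !inE => /andP[/andP[_ xW] /eqP fx] /andP[/andP[_ yW] /eqP fy].
  by apply/negP => /(hf _ _ xW yW); rewrite fx fy eqxx.
have WE : #|W| <= #|A true| + #|A false| + #|N|.
  have -> : W = (A true :|: A false) :|: N.
    apply/setP => x; rewrite !inE -andb_orr.
    by case: (x \in W); case: (f x); case: ([exists y in I, e x y]).
  apply: leq_trans (leq_card_setU _ _) _; rewrite leq_add2r.
  exact: leq_card_setU.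
by have := hA true; have := hA false; rewrite -/N; move: WE; lia.
Qed.

End Colouring.

Lemma card_le_3alpha1 (a : nat) : 2 <= a ->
  (forall A : {set V}, independent A -> #|A| <= a) ->
  (forall m c, odd_circuit m c -> bicolorable (off_circuit m c)) ->
  #|V| <= 3 * a + 1.
Proof.
move=> a2 alpha dol.
have [/(bicolorable_card alpha)|[m [c [circ cmin]]]] := shortest_odd_circuit.
  by rewrite cardsT; lia.
have bic := dol _ _ circ; have Wa := bicolorable_card alpha bic.
set W := off_circuit m c in bic Wa; have VW : #|V| <= #|W| + m.*2.+1 by exact: card_off_circuit.
have [m1|m1] := leqP m 1; first by lia.
have hrun (s : 'I_m.*2.+1) : m.*2 + #|W| <=
    a.*2 + #|[set x in W | [exists y in run m c s, e x y]]|.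
  rewrite -{1}(card_run circ cmin s); apply: bicolorable_card_independent => //.
    exact: run_independent.
  rewrite disjoint_subset; apply/subsetP => _ /imsetP[r _ ->]; rewrite inE.
  by apply/negP => /(off_circuitP circ) h; move/eqP: (h (s + r.+1).*2).
have sumrun : \sum_(s < m.*2.+1) #|[set x in W | [exists y in run m c s, e x y]]|
    <= #|W| * m.+1.
  have -> : \sum_(s < m.*2.+1) #|[set x in W | [exists y in run m c s, e x y]]|
     = \sum_(x in W) #|[set s : 'I_m.*2.+1 | [exists y in run m c s, e x y]]|.
    transitivity (\sum_(s < m.*2.+1)
        \sum_(x in [set x in W | [exists y in run m c s, e x y]]) 1).
      by apply: eq_bigr => s _; rewrite sum1_card.
    rewrite (exchange_big_dep (mem W)) /= => [|s x _]; last by rewrite inE => /andP[].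
    apply: eq_bigr => x xW; rewrite -sum1_card.
    by apply: eq_bigl => s; move: xW; rewrite !inE => ->.
  rewrite -sum_nat_const; apply: leq_sum => x _; exact: run_incidence.
have : m.*2.+1 * (m.*2 + #|W|) <= m.*2.+1 * a.*2 + #|W| * m.+1.
  apply: leq_trans (leq_add (leqnn _) sumrun).
  rewrite -[X in X * (_ + _)]card_ord -[X in X * a.*2]card_ord -!sum_nat_const -big_split /=.
  by apply: leq_sum => s _; exact: hrun.
(* If n >= 3a + 2, then a <= 2m - 1 since w <= 2a, and the averaged inequality gives m (2m + 3) <= a
   (m + 2) <= (2m - 1)(m + 2) = m (2m + 3) - 2. *)
rewrite leqNgt; move: VW Wa; move: #|W| #|V| => w n *; apply/negP => ?; nia.
Qed.

End Walks.

(** * Graphs without three independent vertices *)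

Lemma graph_iso_inj (T T' : finType) (e : rel T) (e' : rel T') (g : T' -> T) :
  injective g -> #|T| <= #|T'| -> (forall x y, e (g x) (g y) = e' x y) ->
  graph_iso e e'.
Proof.
move=> gi cardT ge; have [f gK fK] := inj_card_bij gi cardT.
by exists f => [|x y]; [exists g | rewrite -ge !fK].
Qed.

Lemma notin_image (I T : finType) (f : I -> T) (u : T) :
  u \in ~: [set f i | i : I] -> forall i, u != f i.
Proof. by rewrite inE => h i; apply: contra h => /eqP->; rewrite imset_f. Qed.

(** [a] and [b] are the adjacencies of two vertices to an induced pentagon, [t] their mutual
    adjacency. The hypotheses exclude three independent vertices, a K_4 and two disjoint triangles;
    the cases are then exhausted. *)
Lemma cycle5_pigeonhole (a b : 'I_5 -> bool) (t : bool) :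
  (forall i, a i || a (ordS (ordS i))) -> (forall i, b i || b (ordS (ordS i))) ->
  (forall i, [|| t, a i | b i]) ->
  (forall i, ~~ [&& t, a i, a (ordS i), b i & b (ordS i)]) ->
  (forall i j, j = ordS (ordS i) ->
     ~~ [&& a i, a (ordS i), b j & b (ordS j)]) ->
  (forall i j, j = ordS (ordS i) ->
     ~~ [&& b i, b (ordS i), a j & a (ordS j)]) -> False.
Proof.
move=> ha hb ht hk hab hba.
have {}hab i : ~~ [&& a i, a (ordS i), b (ordS (ordS i)) & b (ordS (ordS (ordS i)))].
  exact: hab.
have {}hba i : ~~ [&& b i, b (ordS i), a (ordS (ordS i)) & a (ordS (ordS (ordS i)))].
  exact: hba.
pose o (k : nat) : 'I_5 := inord k.
have oS k : k < 5 -> ordS (o k) = o (k.+1 %% 5).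
  by move=> k5; apply: ord_inj; rewrite /= !inordK // ltn_mod.
move: (ha (o 0)) (ha (o 1)) (ha (o 2)) (ha (o 3)) (ha (o 4)).
move: (hb (o 0)) (hb (o 1)) (hb (o 2)) (hb (o 3)) (hb (o 4)).
move: (ht (o 0)) (ht (o 1)) (ht (o 2)) (ht (o 3)) (ht (o 4)).
move: (hk (o 0)) (hk (o 1)) (hk (o 2)) (hk (o 3)) (hk (o 4)).
move: (hab (o 0)) (hab (o 1)) (hab (o 2)) (hab (o 3)) (hab (o 4)).
move: (hba (o 0)) (hba (o 1)) (hba (o 2)) (hba (o 3)) (hba (o 4)).
rewrite !(oS 0, oS 1, oS 2, oS 3, oS 4) //=; clear ha hb ht hk hab hba.
case: (a (o 0)); case: (a (o 1)); case: (a (o 2)); case: (a (o 3));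
case: (a (o 4)) => //=;
case: (b (o 0)); case: (b (o 1)); case: (b (o 2)); case: (b (o 3));
case: (b (o 4)) => //=; by case: t.
Qed.

Section SmallGraphs.
Variables (V : finType) (e : rel V).
Hypotheses (esym : symmetric e) (eirr : irreflexive e).
Hypothesis alpha2 : forall A : {set V}, independent e A -> #|A| <= 2.
Hypothesis dolnikov :
  forall m c, odd_circuit e m c -> bicolorable e (off_circuit m c).
Hypothesis K5_minus_edge : forall a b c u v : V,
  e a b -> e a c -> e b c -> e u a -> e u b -> e u c -> e v a -> e v b -> e v c ->
  u = v.

Let e_neq x y : e x y -> x != y.
Proof. by apply: contraTneq => ->; rewrite eirr. Qed.

Lemma edge_of_three x y z : x != y -> y != z -> x != z ->
  [|| e x y, e y z | e x z].
Proof.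
move=> xy yz xz; apply/negPn/negP; rewrite !negb_or => /and3P[nxy nyz nxz].
have : independent e [set x; y; z].
  apply/independentP => u v; rewrite !inE -!orbA.
  by move=> /or3P[] /eqP-> /or3P[] /eqP->; rewrite ?eirr // esym.
move=> /alpha2; rewrite -setUA cardsU1 cards2 !inE negb_or xy xz yz //.
Qed.

(** A triangle is an odd circuit with m = 1, and a triangle disjoint from it cannot be
    2-coloured. *)
Lemma no_disjoint_triangles x y z a b c :
  e x y -> e y z -> e x z -> e a b -> e b c -> e a c ->
  ~ (forall u v, u \in [:: x; y; z] -> v \in [:: a; b; c] -> u != v).
Proof.
move=> xy yz xz ab bc ac dis.
pose f i := nth x [:: x; y; z] (i %% 3).
have [|g hg] := @dolnikov 1 f.
  split=> i; last by rewrite /f modnDr.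
  have : i.+1 %% 3 = (i %% 3).+1 %% 3 by rewrite -addn1 -modnDml addn1.
  rewrite /f => ->; have : i %% 3 < 3 by rewrite ltn_mod.
  by case: (i %% 3) => [|[|[|]]] //= _; rewrite esym.
have off v : v \in [:: a; b; c] -> v \in off_circuit 1 f.
  move=> vabc; rewrite inE; apply/forallP => i; rewrite eq_sym; apply: dis => //.
  by apply: mem_nth; rewrite ltn_mod.
have := hg a b; have := hg b c; have := hg a c.
rewrite !off ?inE ?eqxx ?orbT // => /(_ isT isT ac) + /(_ isT isT bc) + /(_ isT isT ab).
by case: (g a); case: (g b); case: (g c).
Qed.

Definition is_K4 (k : 'I_4 -> V) : Prop := forall i j, e (k i) (k j) = (i != j).

Lemma clique_K4 (A : {set V}) : 4 <= #|A| ->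
  {in A &, forall x y, x != y -> e x y} -> exists k, is_K4 k.
Proof.
move=> A4 cl; exists (fun i => enum_val (widen_ord A4 i)) => i j.
have [->|ij] := eqVneq i j; first by rewrite eirr.
apply: cl; rewrite ?enum_valP // (inj_eq enum_val_inj).
by apply: contra ij => /eqP[/ord_inj->].
Qed.

(** * Graphs containing a K_4 *)

Section K4.
Variable k : 'I_4 -> V.
Hypothesis kE : is_K4 k.
Definition K4_nbrs u : {set 'I_4} := [set i | e u (k i)].
Definition off_K4 u := forall i, u != k i.

Lemma K4_inj : injective k.
Proof.
move=> i j kij; apply/eqP/negPn; rewrite -kE kij eirr //.
Qed.

(** [K5_minus_edge] would identify a vertex having three neighbours in the K_4 with the fourth
    vertex of the K_4. *)
Lemma card_K4_nbrs u : off_K4 u -> #|K4_nbrs u| <= 2.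
Proof.
move=> uk; rewrite leqNgt; apply/card_gt2P => -[i [j [l [[]]]]].
rewrite !inE => ui uj ul [ij jl li].
have [m] : exists m, m \in ~: [set i; j; l].
  apply/card_gt0P; rewrite cardsCs setCK card_ord subn_gt0.
  by rewrite -setUA cardsU1 cards2 !inE; case: (_ || _); case: (_ != _).
rewrite !inE !negb_or => /andP[/andP[mi mj] ml].
have um : u = k m.
  by apply: (@K5_minus_edge (k i) (k j) (k l)); rewrite ?kE // eq_sym.
by have := uk m; rewrite um eqxx.
Qed.

Lemma K4_nbrs_22 u v : off_K4 u -> off_K4 v -> u != v ->
  [disjoint K4_nbrs u & K4_nbrs v] -> #|K4_nbrs u| = 2 -> #|K4_nbrs v| = 2 -> False.
Proof.
move=> uk vk uv dis /eqP/cards2P[i [j [ij Nu]]] /eqP/cards2P[l [m [lm Nv]]].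
have [ui uj] : e u (k i) /\ e u (k j).
  by have := in_set2 i i j; have := in_set2 j i j; rewrite -Nu !inE !eqxx orbT.
have [vl vm] : e v (k l) /\ e v (k m).
  by have := in_set2 l l m; have := in_set2 m l m; rewrite -Nv !inE !eqxx orbT.
have nk a b : a \in K4_nbrs u -> b \in K4_nbrs v -> k a != k b.
  move=> au bv; rewrite (inj_eq K4_inj); apply: contraTneq bv => <-.
  by have /disjointFr/(_ au)-> := dis.
apply: (no_disjoint_triangles (x := u) (y := k i) (z := k j) (a := v) (b := k l) (c := k m));
  rewrite ?kE //.
move=> x y; rewrite !inE => /or3P[] /eqP-> /or3P[] /eqP-> //; rewrite ?uk //.
- by rewrite eq_sym vk.
- by apply: nk; rewrite inE.
- by apply: nk; rewrite inE.
- by rewrite eq_sym vk.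
- by apply: nk; rewrite inE.
- by apply: nk; rewrite inE.
Qed.

(** Otherwise [edge_of_three] makes each vertex of the K_4 a neighbour of [u] or [v], which splits
    it into two pairs, against [K4_nbrs_22]. *)
Lemma off_K4_adj u v : off_K4 u -> off_K4 v -> u != v -> e u v.
Proof.
move=> uk vk uv; apply/negPn/negP => nuv.
have cover i : (i \in K4_nbrs u) || (i \in K4_nbrs v).
  case/or3P: (edge_of_three uv (vk i) (uk i)) => h; rewrite !inE ?h ?orbT //.
  by rewrite h in nuv.
have UT : K4_nbrs u :|: K4_nbrs v = setT.
  by apply/setP => i; rewrite in_setU cover inE.
have := cardsUI (K4_nbrs u) (K4_nbrs v); rewrite UT cardsT card_ord => cU.
have u2 := card_K4_nbrs uk; have v2 := card_K4_nbrs vk.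
apply: (K4_nbrs_22 uk vk uv); last 2 first.
- lia.
- lia.
by rewrite -setI_eq0 -cards_eq0; apply/eqP; lia.
Qed.

Lemma K4_nbrs_disjoint u v : off_K4 u -> off_K4 v -> u != v ->
  [disjoint K4_nbrs u & K4_nbrs v].
Proof.
move=> uk vk uv; rewrite -setI_eq0; apply/set0Pn => -[i].
rewrite !inE => /andP[ui vi].
pose l a : 'I_4 := lift i (inord a : 'I_3).
have lE a b : a < 3 -> b < 3 -> a != b -> e (k (l a)) (k (l b)).
  move=> a3 b3; rewrite kE /l (inj_eq lift_inj); apply: contra => /eqP/(congr1 val).
  by rewrite /= !inordK // => ->.
apply: (no_disjoint_triangles (x := u) (y := v) (z := k i)
   (a := k (l 0)) (b := k (l 1)) (c := k (l 2))); rewrite ?lE ?ui ?vi // ?off_K4_adj //.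
move=> x y; rewrite !inE => /or3P[] /eqP-> /or3P[] /eqP->; rewrite ?uk ?vk //;
 by rewrite (inj_eq K4_inj) neq_lift.
Qed.

Lemma K4_card : #|V| <= 6.
Proof.
rewrite leqNgt; apply/negP => V7.
have : 2 < #|~: [set k i | i : 'I_4]|.
  by have := cardsC [set k i | i : 'I_4]; rewrite card_imset ?card_ord; [lia|exact: K4_inj].
move=> /card_gt2P[x [y [z [[xk yk zk] [xy yz zx]]]]].
have {}xk := notin_image xk; have {}yk := notin_image yk; have {}zk := notin_image zk.
apply: (no_disjoint_triangles (x := x) (y := y) (z := z)
   (a := k ord0) (b := k (inord 1)) (c := k (inord 2))).
- exact: off_K4_adj.
- exact: off_K4_adj.
- by apply: off_K4_adj => //; rewrite eq_sym.
- by rewrite kE -val_eqE /= inordK.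
- by rewrite kE -val_eqE /= !inordK.
- by rewrite kE -val_eqE /= inordK.
by move=> u v; rewrite !inE => /or3P[] /eqP-> /or3P[] /eqP->.
Qed.

Lemma K4_one_of_eight : #|V| = 6 -> one_of_eight e.
Proof.
move=> V6; apply: Or44.
have : 1 < #|~: [set k i | i : 'I_4]|.
  by have := cardsC [set k i | i : 'I_4]; rewrite card_imset ?card_ord; [lia|exact: K4_inj].
move=> /card_gt1P[u [v [uk vk uv]]].
have {}uk := notin_image uk; have {}vk := notin_image vk.
wlog le : u v uk vk uv / #|K4_nbrs v| <= #|K4_nbrs u| => [th|].
  case/orP: (leq_total #|K4_nbrs v| #|K4_nbrs u|) => h; first exact: (th u v).
  by apply: (th v u) => //; rewrite eq_sym.
exists (K4_nbrs u), (K4_nbrs v); split.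
- exact: K4_nbrs_disjoint.
- have := K4_nbrs_22 uk vk uv (K4_nbrs_disjoint uk vk uv).
  have := card_K4_nbrs uk; move: le.
  by case: #|K4_nbrs u| => [|[|[|]]] //; case: #|K4_nbrs v| => [|[|[|]]] // _ _ /(_ erefl).
pose g (x : 'I_4 + bool) := match x with inl i => k i | inr s => if s then v else u end.
apply: (@graph_iso_inj _ _ _ _ g).
- move=> [i|s] [j|t] /=; first by move=> /K4_inj->.
  + by case: t => /eqP; rewrite eq_sym ?(negbTE (uk _)) ?(negbTE (vk _)).
  + by case: s => /eqP; rewrite ?(negbTE (uk _)) ?(negbTE (vk _)).
  by case: s; case: t => // /eqP; rewrite ?(negbTE uv) // eq_sym (negbTE uv).
- by rewrite card_sum card_ord card_bool V6.
have euv := off_K4_adj uk vk uv.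
move=> [i|[]] [j|[]] //=; rewrite ?kE ?eirr // 1?esym ?inE //.
Qed.

End K4.

(** * Graphs containing an induced pentagon *)

Section C5.
Variable q : 'I_5 -> V.
Hypothesis qE : forall i j, e (q i) (q j) = cycle5 i j.
Hypothesis qinj : injective q.
Hypothesis noK4 : ~ exists k, is_K4 k.

Definition missed w : {set 'I_5} := [set i | ~~ e w (q i)].
Definition off_C5 w := forall i, w != q i.

Lemma missed_clique w i j : off_C5 w -> i \in missed w -> j \in missed w ->
  i != j -> cycle5 i j.
Proof.
move=> wq; rewrite !inE => wi wj ij; have := edge_of_three (wq i) _ (wq j).
by rewrite (inj_eq qinj) (negbTE wi) (negbTE wj) orbF -qE; apply.
Qed.

(** The missed vertices form a clique of the pentagon: none, one, or two adjacent ones. *)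
Lemma C5_one_of_eight w : off_C5 w -> #|V| = 6 -> one_of_eight e.
Proof.
move=> wq V6.
have iso : graph_iso e (wheel5_minus (missed w)).
  pose g (x : option 'I_5) := if x is Some i then q i else w.
  apply: (@graph_iso_inj _ _ _ _ g).
  - move=> [i|] [j|] //=; first by move=> /qinj->.
      by move=> /eqP; rewrite eq_sym (negbTE (wq _)).
    by move=> /eqP; rewrite (negbTE (wq _)).
  - by rewrite card_option card_ord V6.
  by move=> [i|] [j|] //=; rewrite ?eirr // ?inE ?negbK // esym.
have cl := @missed_clique w _ _ wq; move: iso cl; move: (missed w) => M iso cl.
have M2 : #|M| <= 2.
  rewrite leqNgt; apply/card_gt2P => -[i [j [l [[iM jM lM] [ij jl li]]]]].
  move: (cl _ _ iM jM ij) (cl _ _ jM lM jl) (cl _ _ lM iM li).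
  rewrite /cycle5 -!val_eqE /=; have := ltn_ord i; have := ltn_ord j; have := ltn_ord l.
  by move: (i : nat) (j : nat) (l : nat) => [|[|[|[|[|]]]]] [|[|[|[|[|]]]]] [|[|[|[|[|]]]]].
move: M2; rewrite leq_eqVlt ltnS leq_eqVlt ltnS leqn0 => /or3P[|/cards1P[i Mi]|].
- move=> /cards2P[i [j [ij Mij]]]; apply: Or43; exists i, j; rewrite -Mij; split=> //.
  by apply: cl; rewrite // Mij !inE eqxx ?orbT.
- by apply: Or42; exists i; rewrite -Mi.
by rewrite cards_eq0 => /eqP M0; apply: Or41; rewrite -M0.
Qed.

Lemma C5_off_uniq w1 w2 : off_C5 w1 -> off_C5 w2 -> w1 = w2.
Proof.
move=> w1q w2q; apply/eqP/negPn/negP => w12.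
have qS i : e (q i) (q (ordS i)) by rewrite qE /cycle5 eqxx.
have cov w i : off_C5 w -> e w (q i) || e w (q (ordS (ordS i))).
  move=> wq; apply/negPn/negP; rewrite negb_or => /andP[ni nj].
  have := @missed_clique w i (ordS (ordS i)) wq; rewrite !inE => /(_ ni nj).
  by rewrite /cycle5 -!val_eqE /=; case: i {ni nj} => [[|[|[|[|[|]]]]]] //= _ /(_ isT).
have tri w w' i j : off_C5 w -> off_C5 w' -> w != w' -> j = ordS (ordS i) ->
    ~~ [&& e w (q i), e w (q (ordS i)), e w' (q j) & e w' (q (ordS j))].
  move=> wq w'q ww' ->; apply/negP => /and4P[a1 a2 b1 b2].
  apply: (no_disjoint_triangles a1 (qS i) a2 b1 (qS _) b2) => x y.
  rewrite !inE => /or3P[] /eqP-> /or3P[] /eqP->; rewrite ?ww' ?wq // 1?eq_sym ?w'q //;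
    by rewrite (inj_eq qinj) -val_eqE /=; case: i {a1 a2 b1 b2} => [[|[|[|[|[|]]]]]].
apply: (@cycle5_pigeonhole (fun i => e w1 (q i)) (fun i => e w2 (q i)) (e w1 w2)).
- by move=> i; exact: cov.
- by move=> i; exact: cov.
- by move=> i; have := edge_of_three w12 (w2q i) (w1q i); rewrite (orbC (e w1 (q i))).
- move=> i; apply/negP => /and5P[t a1 a2 b1 b2]; apply: noK4.
  have qi : q i != q (ordS i) by exact: e_neq.
  apply: (@clique_K4 [set w1; w2; q i; q (ordS i)]).
    by rewrite -!setUA cardsU1 cardsU1 cards2 !inE !negb_or w12 qi !w1q !w2q.
  move=> x y; rewrite !inE -!orbA => /or4P[] /eqP-> /or4P[] /eqP->;
    rewrite ?eqxx // => _; by rewrite // esym.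
- by move=> i j; apply: tri.
- by move=> i j; apply: tri; rewrite // eq_sym.
Qed.

End C5.

(** If the complement [h] is 2-colourable, two cliques cover the graph: one has four vertices, or
    both contain triangles. Otherwise the length of the shortest odd circuit of [h] decides. *)
Lemma C5_or_K4 : 6 <= #|V| -> (exists k, is_K4 k) \/
  exists2 q : 'I_5 -> V, injective q & forall i j, e (q i) (q j) = cycle5 i j.
Proof.
move=> V6; pose h x y := (x != y) && ~~ e x y.
have hsym : symmetric h by move=> x y; rewrite /h eq_sym esym.
have hirr : irreflexive h by move=> x; rewrite /h eqxx.
have hN x y : x != y -> ~~ h x y -> e x y by rewrite /h => -> /negPn.
have [[f hf]|[m [c [circ cmin]]]] := shortest_odd_circuit hsym.
  pose A b := [set x | f x == b].
  have Acl b : {in A b &, forall x y, x != y -> e x y}.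
    move=> x y; rewrite !inE => /eqP fx /eqP fy xy; apply: hN => //; apply/negP => /hf.
    by rewrite fx fy eqxx !inE => /(_ isT isT).
  have cA : #|A true| + #|A false| = #|V|.
    rewrite -(cardsC (A true)); congr (_ + #|pred_of_set _|).
    by apply/setP => x; rewrite !inE; case: (f x).
  have [b4|b4] := leqP 4 #|A true|; first by left; apply: (clique_K4 b4).
  have [b4'|b4'] := leqP 4 #|A false|; first by left; apply: (clique_K4 b4').
  have /card_gt2P[x [y [z [[xA yA zA] [xy yz zx]]]]] : 2 < #|A true| by lia.
  have /card_gt2P[a [b [d [[aA bA dA] [ab bd da]]]]] : 2 < #|A false| by lia.
  exfalso; apply: (no_disjoint_triangles (x := x) (y := y) (z := z) (a := a) (b := b) (c := d)).
  - exact: (Acl true).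
  - exact: (Acl true).
  - by apply: (Acl true); rewrite // eq_sym.
  - exact: (Acl false).
  - exact: (Acl false).
  - by apply: (Acl false); rewrite // eq_sym.
  move=> u v ux va; have fu : f u = true.
    by move: ux xA yA zA; rewrite !inE => /or3P[] /eqP-> /eqP ? /eqP ? /eqP ?.
  have fv : f v = false.
    by move: va aA bA dA; rewrite !inE => /or3P[] /eqP-> /eqP ? /eqP ? /eqP ?.
  by apply: contraTneq fu => ->; rewrite fv.
have hc i : h (c i) (c i.+1) by case: circ.
have ec i r : 0 < r < m -> e (c i) (c (i + r.*2)).
  move=> rm; apply: hN; last exact: (circuit_even_nadj hsym circ cmin).
  by apply: (circuit_even_neq circ cmin); lia.
have cinj := circuit_inj circ cmin.
(* Lengths 1 and 3 are impossible. Length 5, read in steps of two, is an induced pentagon; length 7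
   gives disjoint triangles on the indices 0, 2, 4 and 6, 8, 10; from length 9 on, the indices 0, 2,
   4, 6 span a K_4. *)
case: m circ cmin ec cinj => [|[|[|[|m]]]] circ cmin ec cinj.
- by have := hc 0; have := circ.2 0; rewrite /= => ->; rewrite hirr.
- have c3 : c 3 = c 0 by exact: (circ.2 0).
  have /andP[n01 e01] := hc 0; have /andP[n12 e12] := hc 1; have /andP[n20 e20] := hc 2.
  have := edge_of_three n01 n12; rewrite -c3 eq_sym => /(_ n20).
  by rewrite c3 (negbTE e01) (negbTE e12) esym -c3 (negbTE e20).
- right; exists (fun i : 'I_5 => c i.*2).
    move=> i j /cinj; case: i => [[|[|[|[|[|]]]]]] //= ip; case: j => [[|[|[|[|[|]]]]]] //= jp => // _; exact: val_inj.
  have c5 i : c (i + 5) = c i := circ.2 i.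
  have E i : e (c i) (c i.+2) by have := ec i 1 isT; rewrite addn2.
  have N i : e (c i) (c i.+1) = false by have /andP[_ /negbTE] := hc i.
  have [c50 c61 c83] : [/\ c 5 = c 0, c 6 = c 1 & c 8 = c 3] by rewrite -(c5 0) -(c5 1) -(c5 3).
  have := E 0; have := E 1; have := E 2; have := E 3; have := E 4.
  have := N 0; have := N 1; have := N 2; have := N 3; have := N 4.
  rewrite c50 c61 => n4 n3 n2 n1 n0 e4 e3 e2 e1 e0.
  have sy x y b : e x y = b -> e y x = b by rewrite esym.
  case=> [[|[|[|[|[|]]]]]] //= ip; case=> [[|[|[|[|[|]]]]]] //= jp;
   rewrite /cycle5 -!val_eqE /= /double /= ?c61 ?c83 ?eirr //; by [|apply: sy].
- exfalso; have c7 i : c (i + 7) = c i := circ.2 i.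
  have E1 i : e (c i) (c i.+2) by have := ec i 1 isT; rewrite addn2.
  have E2 i : e (c i) (c i.+4) by have := ec i 2 isT; rewrite addn4.
  apply: (no_disjoint_triangles (E1 0) (E1 2) (E2 0) (E1 6) (E1 8) (E2 6)) => u v.
  rewrite !inE => /or3P[] /eqP-> /or3P[] /eqP->; by apply/eqP => /cinj.
left; apply: (@clique_K4 [set c 0; c 2; c 4; c 6]).
  rewrite -!setUA cardsU1 cardsU1 cards2 !inE !negb_or.
  by rewrite !e_neq // ?(ec 0 1) ?(ec 0 2) ?(ec 0 3) ?(ec 2 1) ?(ec 2 2) ?(ec 4 1).
move=> x y; rewrite !inE -!orbA => /or4P[] /eqP-> /or4P[] /eqP->;
  rewrite ?eqxx // => _;
  first [exact: (ec 0 1) | exact: (ec 0 2) | exact: (ec 0 3) | exact: (ec 2 1)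
        | exact: (ec 2 2) | exact: (ec 4 1)
        | rewrite esym; first [exact: (ec 0 1) | exact: (ec 0 2) | exact: (ec 0 3)
        | exact: (ec 2 1) | exact: (ec 2 2) | exact: (ec 4 1)]].
Qed.

Lemma card_le6 : #|V| <= 6.
Proof.
have [[k kE]|noK4] := boolp.EM (exists k, is_K4 k); first exact: (K4_card kE).
rewrite leqNgt; apply/negP => V7.
have [//|[q qinj qE]] := C5_or_K4 (ltnW V7).
have : 1 < #|~: [set q i | i : 'I_5]|.
  by have := cardsC [set q i | i : 'I_5]; rewrite card_imset ?card_ord //; lia.
move=> /card_gt1P[w1 [w2 [w1q w2q /eqP]]]; apply.
by apply: (C5_off_uniq qE qinj noK4); apply: notin_image.
Qed.

Lemma card6_one_of_eight : #|V| = 6 -> one_of_eight e.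
Proof.
move=> V6; have := C5_or_K4; rewrite V6 => /(_ isT)[[k kE]|[q qinj qE]].
  exact: (K4_one_of_eight kE).
have /card_gt0P[w wq] : 0 < #|~: [set q i | i : 'I_5]|.
  by have := cardsC [set q i | i : 'I_5]; rewrite card_imset ?card_ord //; lia.
exact: (C5_one_of_eight qE qinj (notin_image wq)).
Qed.

End SmallGraphs.

Import Order.TTheory GRing.Theory Num.Theory.
Import numFieldNormedType.Exports.
Local Open Scope ring_scope.

(** * The two sides of an antipodal curve on the sphere *)

Section Vectors.
Variable R : realType.
Implicit Types x y z p q A B C : 'rV[R]_3.

Let i0 : 'I_3 := ord0.
Let i1 : 'I_3 := lift ord0 ord0.
Let i2 : 'I_3 := lift ord0 (lift ord0 ord0).

Definition dot x y : R := \sum_(i < 3) x ord0 i * y ord0 i.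

Definition det3 x y z : R :=
  x ord0 i0 * (y ord0 i1 * z ord0 i2 - y ord0 i2 * z ord0 i1)
  - x ord0 i1 * (y ord0 i0 * z ord0 i2 - y ord0 i2 * z ord0 i0)
  + x ord0 i2 * (y ord0 i0 * z ord0 i1 - y ord0 i1 * z ord0 i0).

Lemma dotE x y :
  dot x y = x ord0 i0 * y ord0 i0 + x ord0 i1 * y ord0 i1 + x ord0 i2 * y ord0 i2.
Proof. by rewrite /dot !big_ord_recl big_ord0 addr0 addrA. Qed.

Lemma dotC x y : dot x y = dot y x.
Proof. by rewrite !dotE; ring. Qed.
Lemma dotDl x y z : dot (x + y) z = dot x z + dot y z.
Proof. by rewrite !dotE !mxE; ring. Qed.
Lemma dotNl x z : dot (- x) z = - dot x z.
Proof. by rewrite !dotE !mxE; ring. Qed.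
Lemma dotZl a x z : dot (a *: x) z = a * dot x z.
Proof. by rewrite !dotE !mxE; ring. Qed.
Lemma dotDr x y z : dot z (x + y) = dot z x + dot z y.
Proof. by rewrite !(dotC z) dotDl. Qed.
Lemma dotNr x z : dot z (- x) = - dot z x.
Proof. by rewrite !(dotC z) dotNl. Qed.
Lemma dotZr a x z : dot z (a *: x) = a * dot z x.
Proof. by rewrite !(dotC z) dotZl. Qed.
Definition dot_lin := (dotDl, dotDr, dotNl, dotNr, dotZl, dotZr).

Lemma dot0l x : dot 0 x = 0.
Proof. by rewrite -(scale0r 0) dotZl mul0r. Qed.
Lemma dot0r x : dot x 0 = 0.
Proof. by rewrite dotC dot0l. Qed.

Lemma dot_ge0 x : 0 <= dot x x.
Proof. by apply: sumr_ge0 => i _; rewrite -expr2 sqr_ge0. Qed.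

Lemma dot_eq0 x : (dot x x == 0) = (x == 0).
Proof.
rewrite psumr_eq0; last by move=> i _; rewrite -expr2 sqr_ge0.
apply/allP/eqP => [h|-> i _]; last by rewrite /= mxE mulr0 eqxx.
apply/rowP => i; rewrite mxE; apply/eqP.
by have := h i (mem_index_enum _); rewrite /= -expr2 sqrf_eq0.
Qed.

Lemma dot_gt0 x : x != 0 -> 0 < dot x x.
Proof. by move=> x0; rewrite lt0r dot_eq0 x0 dot_ge0. Qed.

(** Equality case of the Cauchy-Schwarz inequality. *)
Lemma parallel_of_dot p v : dot p p * dot v v = dot p v ^+ 2 ->
  dot p p *: v = dot p v *: p.
Proof.
move=> h; apply/eqP; rewrite -subr_eq0 -dot_eq0; apply/eqP.
transitivity (dot p p * (dot p p * dot v v - dot p v ^+ 2)).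
  by rewrite !dot_lin (dotC v p); ring.
by rewrite h subrr mulr0.
Qed.

End Vectors.

(** * Half-angles swept around a direction by a spherical polygon *)

Section Winding.
Variable R : realType.
Implicit Types p q A B C : 'rV[R]_3.

(* Up to the factor dot p p, the real and imaginary parts of the ratio, in the
   plane orthogonal to p, of the projections of B and A. *)
Definition shadow_dot p A B : R := dot p p * dot A B - dot p A * dot p B.
Definition shadow_det p A B : R := Num.sqrt (dot p p) * det3 p A B.

(* For a complex number z = x + i y off the negative real axis, z + |z| has half the
   argument of z. *)
Definition half_angle p A B : R * R :=
  let x := shadow_dot p A B in let y := shadow_det p A B in
  (x + Num.sqrt (x ^+ 2 + y ^+ 2), y).

Definition cmul (u v : R * R) : R * R :=
  (u.1 * v.1 - u.2 * v.2, u.1 * v.2 + u.2 * v.1).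

(* The argument of the turning is half the angle swept around p by the polygon P.
   If P n = - P 0 this angle is an odd multiple of pi, so the turning is purely
   imaginary, and its sign tells on which side of the curve p lies. *)
Fixpoint turning (P : nat -> 'rV[R]_3) n p : R * R :=
  if n is n'.+1 then cmul (turning P n' p) (half_angle p (P n') (P n'.+1))
  else (1, 0).

(** Equivalently, A and B are non-zero and not in opposite directions: their cone cuts the sphere in
    less than half a great circle. *)
Definition short_arc A B : Prop :=
  forall a b : R, 0 <= a -> 0 <= b -> a *: A + b *: B = 0 -> a = 0 /\ b = 0.

(* Neither p nor - p lies in the cone spanned by A and B. *)
Definition misses p A B : Prop :=
  forall a b t : R, 0 <= a -> 0 <= b -> a *: A + b *: B = t *: p -> t = 0.

Lemma shadow_cauchy p A B :
  shadow_dot p A A * shadow_dot p B B =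
  shadow_dot p A B ^+ 2 + dot p p * det3 p A B ^+ 2.
Proof. by rewrite /shadow_dot /det3 !dotE; ring. Qed.

(** Together with the next identity: the real and imaginary parts of (B/A)(C/B) = C/A for the
    projections as complex numbers, denominators cleared. *)
Lemma shadow_chain_re p A B C :
  shadow_dot p A B * shadow_dot p B C - dot p p * (det3 p A B * det3 p B C) =
  shadow_dot p B B * shadow_dot p A C.
Proof. by rewrite /shadow_dot /det3 !dotE; ring. Qed.

Lemma shadow_chain_im p A B C :
  shadow_dot p A B * det3 p B C + det3 p A B * shadow_dot p B C =
  shadow_dot p B B * det3 p A C.
Proof. by rewrite /shadow_dot /det3 !dotE; ring. Qed.

Lemma shadow_gt0 p A : p != 0 -> (forall t, A <> t *: p) -> 0 < shadow_dot p A A.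
Proof.
move=> p0 Ap; rewrite lt0r.
have -> : shadow_dot p A A = dot p p * dot A A - dot p A ^+ 2 by rewrite /shadow_dot expr2.
apply/andP; split.
  apply/negP; rewrite subr_eq0 => /eqP/parallel_of_dot h; apply: (Ap (dot p A / dot p p)).
  by rewrite mulrC -scalerA -h scalerA mulVf ?scale1r // dot_eq0.
have := dot_ge0 (dot p p *: A - dot p A *: p).
have -> : dot (dot p p *: A - dot p A *: p) (dot p p *: A - dot p A *: p) =
    dot p p * (dot p p * dot A A - dot p A ^+ 2).
  by rewrite !dot_lin (dotC A p); ring.
by rewrite pmulr_rge0 // dot_gt0.
Qed.

Lemma misses_nparallel p A B : short_arc A B -> misses p A B ->
  (forall t, A <> t *: p) /\ (forall t, B <> t *: p).
Proof.
move=> sAB mis; split=> t E.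
  have t0 : t = 0 by apply: (mis 1 0); rewrite // scale1r scale0r addr0.
  have [] := sAB 1 0; rewrite ?E ?t0 ?ler01 // ?scale0r ?scaler0 ?addr0 //.
  by move=> /eqP; rewrite oner_eq0.
have t0 : t = 0 by apply: (mis 0 1); rewrite // scale1r scale0r add0r.
have [] := sAB 0 1; rewrite ?E ?t0 ?ler01 // ?scale0r ?scaler0 ?addr0 //.
by move=> _ /eqP; rewrite oner_eq0.
Qed.

(** Opposite projections would have a combination with non-negative coefficients on the line of [p],
    against [misses] and [short_arc]. *)
Lemma shadow_not_antipodal p A B : p != 0 -> short_arc A B -> misses p A B ->
  det3 p A B = 0 -> 0 < shadow_dot p A B.
Proof.
move=> p0 sAB mis d0; rewrite ltNge; apply/negP => le0.
have [nA nB] := misses_nparallel sAB mis.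
have B0 := shadow_gt0 p0 nB.
pose a := shadow_dot p B B; pose b := - shadow_dot p A B.
pose v := a *: A + b *: B.
have vv : shadow_dot p v v = 0.
  have -> : shadow_dot p v v = a ^+ 2 * shadow_dot p A A + 2 * (a * b) * shadow_dot p A B
     + b ^+ 2 * shadow_dot p B B.
    by rewrite /v /shadow_dot !dot_lin (dotC B A); ring.
  have := shadow_cauchy p A B; rewrite d0 expr0n mulr0 addr0 /a /b => E.
  have -> : forall x y z : R, y ^+ 2 * x + 2 * (y * - z) * z + (- z) ^+ 2 * y = y * (x * y - z ^+ 2).
    by move=> x y z; ring.
  by rewrite E subrr mulr0.
have : dot p p *: v = dot p v *: p.
  by apply: parallel_of_dot; apply/eqP; rewrite -subr_eq0 expr2 -vv.
rewrite /v scalerDr !scalerA => E.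
have pp := dot_gt0 p0.
have a0 : 0 <= dot p p * a by rewrite mulr_ge0 // ltW.
have b0 : 0 <= dot p p * b by rewrite mulr_ge0 ?oppr_ge0 // ltW.
have t0 := mis _ _ _ a0 b0 E; move: E; rewrite t0 scale0r => /(sAB _ _ a0 b0)[/eqP].
by rewrite mulf_eq0 (gt_eqF pp) (gt_eqF B0).
Qed.

(** With r = |x + i y|, (x + r + i y)^2 = 2 (x + r)(x + i y), and x + r > 0 off the non-positive
    real axis. *)
Lemma cmul_half_angle p A B (z := half_angle p A B) :
  p != 0 -> short_arc A B -> misses p A B ->
  exists2 l : R, 0 < l &
    cmul z z = (l * shadow_dot p A B, l * shadow_det p A B).
Proof.
move=> p0 sAB mis; rewrite /z /half_angle /cmul /=.
set x := shadow_dot p A B; set y := shadow_det p A B.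
have r2 : Num.sqrt (x ^+ 2 + y ^+ 2) ^+ 2 = x ^+ 2 + y ^+ 2.
  by rewrite sqr_sqrtr // addr_ge0 ?sqr_ge0.
have r0 := sqrtr_ge0 (x ^+ 2 + y ^+ 2).
move: r2 r0; set r := Num.sqrt _ => r2 r0.
have xr : 0 < x + r.
  have [y0|y0] := eqVneq y 0.
    have d0 : det3 p A B = 0.
      move/eqP: y0; rewrite mulf_eq0 sqrtr_eq0 => /orP[|/eqP//].
      by rewrite leNgt dot_gt0.
    by have := shadow_not_antipodal p0 sAB mis d0; rewrite -/x; lra.
  have y2 : 0 < y ^+ 2 by rewrite lt0r sqrf_eq0 y0 sqr_ge0.
  rewrite ltNge; apply/negP => le; nra.
exists (2 * (x + r)); first by lra.
congr pair; last by ring.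
have -> : (x + r) * (x + r) - y * y = 2 * (x + r) * x + (r ^+ 2 - (x ^+ 2 + y ^+ 2)) by ring.
by rewrite r2 subrr addr0.
Qed.

Lemma continuous_dot_line p v A : continuous (fun t : R => dot (p + t *: v) A).
Proof.
have -> : (fun t : R => dot (p + t *: v) A) = (fun t => dot p A + t * dot v A).
  by apply: boolp.funext => t; rewrite !dot_lin.
by move=> t; apply: cvgD; [exact: cvg_cst | apply: cvgM; [exact: cvg_id | exact: cvg_cst]].
Qed.

Lemma continuous_det3_line p v A B :
  continuous (fun t : R => det3 (p + t *: v) A B).
Proof.
have -> : (fun t : R => det3 (p + t *: v) A B) =
    (fun t => det3 p A B + t * det3 v A B).
  by apply: boolp.funext => t; rewrite /det3 !mxE; ring.
by move=> t; apply: cvgD; [exact: cvg_cst | apply: cvgM; [exact: cvg_id | exact: cvg_cst]].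
Qed.

Lemma continuous_norm2_line p v :
  continuous (fun t : R => dot (p + t *: v) (p + t *: v)).
Proof.
have -> : (fun t : R => dot (p + t *: v) (p + t *: v)) =
    (fun t => dot (p + t *: v) p + t * dot (p + t *: v) v).
  by apply: boolp.funext => t; rewrite [in LHS]dotDr dotZr.
move=> t; apply: cvgD; first exact: continuous_dot_line.
by apply: cvgM; [exact: cvg_id | exact: continuous_dot_line].
Qed.

Lemma half_angle_continuous p v A B :
  continuous (fun t : R => (half_angle (p + t *: v) A B).1) /\
  continuous (fun t : R => (half_angle (p + t *: v) A B).2).
Proof.
have sc f : continuous f -> continuous (fun t : R => Num.sqrt (f t : R)).
  by move=> fc t; apply: continuous_comp; [exact: fc | exact: sqrt_continuous].
have xc : continuous (fun t : R => shadow_dot (p + t *: v) A B).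
  move=> t; apply: cvgB; apply: cvgM; try exact: continuous_dot_line.
    exact: continuous_norm2_line.
  exact: cvg_cst.
have yc : continuous (fun t : R => shadow_det (p + t *: v) A B).
  move=> t; apply: cvgM; last exact: continuous_det3_line.
  exact: (sc _ (@continuous_norm2_line p v)).
split=> //= t; apply: cvgD; first exact: xc.
apply: (sc (fun t : R => shadow_dot (p + t *: v) A B ^+ 2
                       + shadow_det (p + t *: v) A B ^+ 2)) => {}t.
by apply: cvgD; apply: cvgM; first [exact: xc | exact: yc].
Qed.

Lemma turning_continuous P p v n :
  continuous (fun t : R => (turning P n (p + t *: v)).1) /\
  continuous (fun t : R => (turning P n (p + t *: v)).2).
Proof.
elim: n => [|n [IH1 IH2]] /=; first by split=> t; exact: cvg_cst.
have [h1 h2] := half_angle_continuous p v (P n) (P n.+1).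
by split=> t; [apply: cvgB | apply: cvgD]; apply: cvgM;
  first [exact: IH1 | exact: IH2 | exact: h1 | exact: h2].
Qed.

Section Curve.
Variables (P : nat -> 'rV[R]_3) (n : nat).
Hypothesis short : forall i, (i < n)%N -> short_arc (P i) (P i.+1).
Hypothesis n0 : (0 < n)%N.
Hypothesis antipodal : P n = - P 0%N.

Definition avoids p : Prop :=
  p != 0 /\ forall i, (i < n)%N -> misses p (P i) (P i.+1).

Lemma avoids_shadow p i : avoids p -> (i <= n)%N -> 0 < shadow_dot p (P i) (P i).
Proof.
move=> [p0 mis]; rewrite leq_eqVlt => /predU1P[->|lt]; last first.
  by have [h _] := misses_nparallel (short lt) (mis _ lt); apply: shadow_gt0.
case: n n0 short mis => // k _ sh mis.
by have [_ h] := misses_nparallel (sh k (leqnn _)) (mis k (leqnn _)); apply: shadow_gt0.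
Qed.

(** Squaring turns half-angles into angles, and the ratios telescope by the chain identities. *)
Lemma turning_sqr p k : avoids p -> (k <= n)%N ->
  exists2 l : R, 0 < l &
    cmul (turning P k p) (turning P k p) =
    (l * shadow_dot p (P 0%N) (P k), l * shadow_det p (P 0%N) (P k)).
Proof.
move=> av; elim: k => [|k IH] kn.
  exists (shadow_dot p (P 0%N) (P 0%N))^-1; first by rewrite invr_gt0 avoids_shadow.
  rewrite /cmul /= mulVf ?gt_eqF ?avoids_shadow //.
  by congr pair; rewrite /shadow_det /det3; ring.
have [l l0 El] := IH (ltnW kn).
have [l' l'0 El'] := cmul_half_angle av.1 (short kn) (av.2 _ kn).
exists (l * l' * shadow_dot p (P k) (P k)).
  by rewrite !mulr_gt0 // avoids_shadow // ltnW.
move: El El' => /=; move: (turning _ _ _) (half_angle _ _ _) => [x y] [x' y'].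
rewrite /cmul /= => -[E1 E2] [E3 E4].
have sq : Num.sqrt (dot p p) ^+ 2 = dot p p by rewrite sqr_sqrtr // dot_ge0.
have re := shadow_chain_re p (P 0%N) (P k) (P k.+1).
have im := shadow_chain_im p (P 0%N) (P k) (P k.+1).
congr pair.
  transitivity ((x * x - y * y) * (x' * x' - y' * y') - (x * y + y * x) * (x' * y' + y' * x')).
    by ring.
  rewrite E1 E2 E3 E4 -[RHS]mulrA -re /shadow_det.
  by move: sq; move: (Num.sqrt (dot p p)) => s <-; ring.
transitivity ((x * x - y * y) * (x' * y' + y' * x') + (x * y + y * x) * (x' * x' - y' * y')).
  by ring.
rewrite E1 E2 E3 E4 /shadow_det.
transitivity (l * l' * Num.sqrt (dot p p) * (shadow_dot p (P k) (P k) * det3 p (P 0%N) (P k.+1))).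
  by rewrite -im; ring.
by ring.
Qed.

(** At the antipodal end the square has negative real part, so the turning is not real. *)
Lemma turning_neq0 p : avoids p -> (turning P n p).2 != 0.
Proof.
move=> av; have [l l0] := turning_sqr av (leqnn n).
have P0 := avoids_shadow av (leq0n n).
have -> : shadow_dot p (P 0%N) (P n) = - shadow_dot p (P 0%N) (P 0%N).
  by rewrite antipodal /shadow_dot !dot_lin; ring.
case: (turning P n p) => x y; rewrite /cmul /= => -[E _].
apply/negP => /eqP y0; move: E; rewrite y0 mulr0 subr0 => E.
by have := mulr_gt0 l0 P0; nra.
Qed.

Lemma turningN p k : turning P k (- p) = ((turning P k p).1, - (turning P k p).2).
Proof.
elim: k => [|k IH] /=; first by rewrite oppr0.
rewrite IH /cmul /half_angle /=.
have -> A B : shadow_dot (- p) A B = shadow_dot p A B.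
  by rewrite /shadow_dot !dot_lin; ring.
have -> A B : shadow_det (- p) A B = - shadow_det p A B.
  by rewrite /shadow_det !dot_lin opprK /det3 !mxE; ring.
by rewrite sqrrN; congr pair; ring.
Qed.

Definition side p : bool := 0 < (turning P n p).2.

Lemma sideN p : avoids p -> side (- p) = ~~ side p.
Proof.
move=> /turning_neq0 h; rewrite /side turningN /= oppr_gt0 -leNgt.
by rewrite lt_neqAle h.
Qed.

(** The imaginary part of the turning is continuous along the segment and never zero there, so it
    keeps its sign. *)
Lemma side_segment p q :
  (forall t, 0 <= t <= 1 -> avoids (p + t *: (q - p))) -> side p = side q.
Proof.
move=> av; pose f t := (turning P n (p + t *: (q - p))).2.
have fc : continuous f by apply: (turning_continuous P p (q - p) n).2.
have f0 t : 0 <= t <= 1 -> f t != 0 by move=> /av/turning_neq0.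
have -> : side p = (0 < f 0) by rewrite /side /f scale0r addr0.
have -> : side q = (0 < f 1) by rewrite /side /f scale1r addrC subrK.
have sgn v : Num.min (f 0) (f 1) <= v <= Num.max (f 0) (f 1) -> v != 0.
  move=> /(IVT ler01 (continuous_subspaceT fc))[c]; rewrite in_itv /= => c01 <-.
  exact: f0.
have n0' : ~ (Num.min (f 0) (f 1) <= 0 <= Num.max (f 0) (f 1)).
  by move=> /sgn/eqP.
have h0 := f0 0; have h1 := f0 1.
case: (ltP 0 (f 0)); case: (ltP 0 (f 1)) => // a b; case: n0'.
  by rewrite ge_min le_max a (ltW b) orbT.
by rewrite ge_min le_max b (ltW a) orbT.
Qed.

End Curve.
End Winding.

(** * Diameter graphs in space *)

Section Diameters.
Variables (R : realType) (D : R).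
Hypothesis D0 : 0 < D.
Implicit Types x c p q v w : 'rV[R]_3.

(** Squares keep the distance conditions polynomial; [D] is the square of the diameter d. *)
Definition dist2 x c : R := dot (x - c) (x - c).

Lemma dist2C x c : dist2 x c = dist2 c x.
Proof. by rewrite /dist2 -opprB dotNl dotNr opprK. Qed.

Lemma dist2_eq0 x c : (dist2 x c == 0) = (x == c).
Proof. by rewrite /dist2 dot_eq0 subr_eq0. Qed.

Lemma dist2E x c : dist2 x c = dot x x - 2 * dot x c + dot c c.
Proof. by rewrite /dist2 !dot_lin (dotC c x); ring. Qed.

Lemma dist2_subr x c p : dist2 (x - p) (c - p) = dist2 x c.
Proof. by rewrite /dist2 opprB addrA subrK. Qed.

Lemma dist2_subl x c p : dist2 (p - x) (p - c) = dist2 c x.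
Proof. by rewrite /dist2 opprB addrC addrA subrK. Qed.

(** Since |p|^2 = D, the bound |v - p|^2 <= D says |v|^2 <= 2 v.p; this is added to its analogue for
    [q] with weights s and t. *)
Lemma cone_dot p q v (s t : R) : dot p p = D -> dot q q = D ->
  dist2 v p <= D -> dist2 v q <= D -> 0 <= s -> 0 <= t ->
  (s + t) * dot v v <= 2 * dot v (s *: p + t *: q).
Proof.
move=> pD qD; rewrite !dist2E !dot_lin pD qD => vp vq s0 t0; nra.
Qed.

Lemma cone_eq0 p q v (s t : R) : dot p p = D -> dot q q = D ->
  dist2 v p <= D -> dist2 v q <= D -> 0 <= s -> 0 <= t -> v != 0 ->
  dot v (s *: p + t *: q) <= 0 -> s = 0 /\ t = 0.
Proof.
move=> pD qD vp vq s0 t0 v0 le0; have := cone_dot pD qD vp vq s0 t0.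
by have := dot_gt0 v0; split; nra.
Qed.

(* A point w of the arc from p to q of the sphere of radius d around 0 belongs to
   every ball of radius d containing p and q. *)
Lemma spindle p q v w (s t : R) : dot p p = D -> dot q q = D -> dot w w = D ->
  w = s *: p + t *: q -> 0 <= s -> 0 <= t ->
  dist2 v p <= D -> dist2 v q <= D ->
  dist2 v w <= D /\ (dist2 v w = D -> v != 0 -> w = p \/ w = q).
Proof.
move=> pD qD wD E s0 t0 vp vq; have vv := dot_ge0 v.
have := cone_dot pD qD vp vq s0 t0; rewrite -E => vw.
have pq : 0 <= D - dot p q.
  by have := dot_ge0 (p - q); rewrite !dot_lin pD qD (dotC q p); lra.
have wE : D = (s + t) ^+ 2 * D - 2 * (s * t) * (D - dot p q).
  by rewrite -{1}wD E !dot_lin pD qD (dotC q p); ring.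
(* Triangle inequality: [w] has the same length as [p] and [q]. *)
have st1 : 1 <= s + t.
  have stpq : 0 <= s * t * (D - dot p q) by rewrite !mulr_ge0.
  rewrite leNgt; apply/negP => lt1.
  have : 0 < (1 - (s + t)) * (1 + (s + t)) * D by rewrite !mulr_gt0 //; lra.
  by lra.
rewrite dist2E wD; split; first by nra.
move=> vwD /dot_gt0 v0.
(* Equality puts [w] on the chord from [p] to [q], which meets the sphere only at its ends. *)
have st : s + t = 1 by nra.
have : s * t * (D - dot p q) = 0.
  by move: wE; rewrite st expr1n mul1r => wE; lra.
move/eqP; rewrite !mulf_eq0 => /orP[/orP[/eqP s1|/eqP t1]|/eqP pq0].
- by right; rewrite E s1 scale0r add0r (_ : t = 1) ?scale1r //; lra.
- by left; rewrite E t1 scale0r addr0 (_ : s = 1) ?scale1r //; lra.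
left; have /eqP : dist2 p q = 0 by rewrite dist2E pD qD; lra.
by rewrite dist2_eq0 E => /eqP <-; rewrite -scalerDl st scale1r.
Qed.

(* With w of length d in both cones, x + w and c - w lie within d of all the
   points involved and of each other, so that the parallelogram law forces
   c = x + w; the equality case of the spindle lemma then concludes. *)
Lemma cones_opposite x x1 x2 c c1 c2 (s t a b : R) :
  dist2 x1 x = D -> dist2 x2 x = D -> dist2 c c1 = D -> dist2 c c2 = D ->
  dist2 c x <= D -> dist2 c1 x1 <= D -> dist2 c1 x2 <= D ->
  dist2 c2 x1 <= D -> dist2 c2 x2 <= D ->
  c1 != x -> x1 != c -> x2 != c ->
  0 <= s -> 0 <= t -> 0 <= a -> 0 <= b ->
  s *: (x1 - x) + t *: (x2 - x) = a *: (c - c1) + b *: (c - c2) ->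
  s *: (x1 - x) + t *: (x2 - x) = 0.
Proof.
move=> xx1 xx2 cc1 cc2 cx c11 c12 c21 c22 nc1 nx1 nx2.
wlog : s t a b / dot (s *: (x1 - x) + t *: (x2 - x)) (s *: (x1 - x) + t *: (x2 - x)) = D.
  move=> th s0 t0 a0 b0 E; set w := _ + _; apply/eqP; apply/negPn/negP => w0.
  have ww := dot_gt0 w0; pose l := Num.sqrt (D / dot w w).
  have l2 : l ^+ 2 = D / dot w w by rewrite sqr_sqrtr // divr_ge0 // ltW.
  have l0 : 0 < l by rewrite sqrtr_gt0 divr_gt0.
  have lw : l *: w = (l * s) *: (x1 - x) + (l * t) *: (x2 - x).
    by rewrite scalerDr !scalerA.
  have lwD : dot (l *: w) (l *: w) = D.
    by rewrite dotZl dotZr mulrA -expr2 l2 divfK // gt_eqF.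
  have : l *: w = 0.
    rewrite lw; apply: (th _ _ (l * a) (l * b)); rewrite -?lw ?mulr_ge0 // ?ltW //.
    by rewrite /w E scalerDr !scalerA.
  by move=> /eqP; rewrite scaler_eq0 (gt_eqF l0) (negbTE w0).
set w := s *: _ + _ => wD s0 t0 a0 b0 E; exfalso.
have wE : w = s *: (x1 - x) + t *: (x2 - x) by [].
clearbody w.
have near y : dist2 y x1 <= D -> dist2 y x2 <= D -> dist2 (y - x) w <= D /\
    (dist2 (y - x) w = D -> y - x != 0 -> w = x1 - x \/ w = x2 - x).
  by move=> y1 y2; apply: (spindle xx1 xx2 wD wE s0 t0); rewrite dist2_subr.
have [h1 e1] := near c1 c11 c12; have [h2 _] := near c2 c21 c22.
(* [x + w] lies within d of [c1] and [c2], so the spindle lemma at [c] puts it within d of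
   [c - w]. *)
have [h3 _] : dist2 (c - (x + w)) w <= D /\ (dist2 (c - (x + w)) w = D ->
    c - (x + w) != 0 -> w = c - c1 \/ w = c - c2).
  by apply: (spindle cc1 cc2 wD E a0 b0);
    rewrite dist2_subl /dist2 opprD addrA.
(* For u = c - x both u and u - 2w have squared length at most D, while |u|^2 + |u - 2w|^2 = 2 |u -
   w|^2 + 2D. *)
have cxw : c - x = w.
  apply/eqP; rewrite -dist2_eq0; apply/eqP.
  move: h3 cx; rewrite (_ : c - (x + w) = (c - x) - w); last by rewrite opprD addrA.
  rewrite {2}/dist2; move: (c - x) => u; rewrite !dist2E => h3 ux.
  have := dot_ge0 (u - w); move: h3; rewrite !dot_lin wD (dotC w u); lra.
(* As c - x = w, the distance from [c1 - x] to [w] is d; the equality case makes [c] one of [x1],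
   [x2]. *)
case: e1.
- by rewrite -cxw dist2_subr dist2C.
- by rewrite subr_eq0.
- by rewrite -cxw => /addIr/eqP; rewrite eq_sym (negbTE nx1).
- by rewrite -cxw => /addIr/eqP; rewrite eq_sym (negbTE nx2).
Qed.

(** Non-zero vectors of the cone at [x] make acute angles with c - x, those of the cone at [c] with
    x - c. *)
Lemma cones_same x x1 x2 c c1 c2 (s t a b : R) :
  dist2 x1 x = D -> dist2 x2 x = D -> dist2 c1 c = D -> dist2 c2 c = D ->
  dist2 c x1 <= D -> dist2 c x2 <= D -> dist2 x c1 <= D -> dist2 x c2 <= D ->
  c != x -> 0 <= s -> 0 <= t -> 0 <= a -> 0 <= b ->
  s *: (x1 - x) + t *: (x2 - x) = a *: (c1 - c) + b *: (c2 - c) ->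
  s = 0 /\ t = 0.
Proof.
move=> xx1 xx2 cc1 cc2 cx1 cx2 xc1 xc2 ncx s0 t0 a0 b0 E.
apply: (cone_eq0 (v := c - x) xx1 xx2); rewrite ?dist2_subr ?subr_eq0 //.
rewrite E -opprB dotNl oppr_le0.
have := cone_dot (v := x - c) cc1 cc2; rewrite !dist2_subr => /(_ _ _ xc1 xc2 a0 b0).
have : 0 <= (a + b) * dot (x - c) (x - c) by rewrite mulr_ge0 ?dot_ge0 ?addr_ge0.
lra.
Qed.

Lemma det3_gram (x y z w : 'rV[R]_3) : det3 x y z * det3 x y w =
  dot x x * (dot y y * dot z w - dot y w * dot z y)
  - dot x y * (dot x y * dot z w - dot y w * dot z x)
  + dot x w * (dot x y * dot z y - dot y y * dot z x).
Proof. by rewrite /det3 !dotE; ring. Qed.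

(** The determinants X and Y are proportional to the signed heights of [u] and [v] over the plane
    abc and have equal squares. Equal heights give u = v; opposite ones give squared distance 8/3 D,
    above D. *)
Lemma K5_minus_edge_eq (a b c u v : 'rV[R]_3) :
  dist2 a b = D -> dist2 a c = D -> dist2 b c = D ->
  dist2 u a = D -> dist2 u b = D -> dist2 u c = D ->
  dist2 v a = D -> dist2 v b = D -> dist2 v c = D -> dist2 u v <= D -> u = v.
Proof.
move=> ab ac bc ua ub uc va vb vc uv.
have dotD x y : dot (x - a) (y - a) = (dist2 x a + dist2 y a - dist2 x y) / 2.
  by have := dist2E (x - a) (y - a); rewrite dist2_subr -/(dist2 x a) -/(dist2 y a) => ->; field.
have ba : dist2 b a = D by rewrite dist2C.
have ca : dist2 c a = D by rewrite dist2C.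
have d0 x : dist2 x x = 0 by apply/eqP; rewrite dist2_eq0.
have gUW := det3_gram (b - a) (c - a) (u - a) (v - a).
have gUU := det3_gram (b - a) (c - a) (u - a) (u - a).
have gWW := det3_gram (b - a) (c - a) (v - a) (v - a).
move: gUW gUU gWW; rewrite !dotD !d0 ba ca bc ua ub uc va vb vc.
rewrite ?(dist2C b u) ?(dist2C c u) ?(dist2C b v) ?(dist2C c v) ub uc vb vc.
move: (det3 _ _ (u - a)) (det3 _ _ (v - a)) => X Y gUW gUU gWW.
apply/eqP; rewrite -dist2_eq0.
have : (X - Y) * (X + Y) = 0 by rewrite mulrDr !mulrBl gUU gWW (mulrC Y); ring.
move: uv gUW gUU; move: (dist2 u v) => g uv gUW gUU.
move=> /eqP; rewrite mulf_eq0 subr_eq0 addr_eq0 => /orP[]/eqP XY.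
  have : D ^+ 2 * g = 0 by rewrite XY in gUU gUW; lra.
  by move/eqP; rewrite mulf_eq0 expf_eq0 /= (gt_eqF D0).
have : D ^+ 2 * (g - 8 / 3 * D) = 0 by rewrite XY in gUU gUW; lra.
move/eqP; rewrite mulf_eq0 expf_eq0 /= (gt_eqF D0) /= subr_eq0 => /eqP gE.
by exfalso; move: D0 uv; lra.
Qed.

(** * Dol'nikov's theorem for diameter graphs *)

Section Graph.
Variables (V : finType) (pos : V -> 'rV[R]_3) (e : rel V).
Hypothesis pos_inj : injective pos.
Hypothesis pos_le : forall x y : V, dist2 (pos x) (pos y) <= D.
Hypothesis eE : forall x y : V, e x y = (dist2 (pos x) (pos y) == D).

Let esym : symmetric e.
Proof. by move=> x y; rewrite !eE dist2C. Qed.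

Let eP (x y : V) : e x y -> dist2 (pos x) (pos y) = D.
Proof. by rewrite eE => /eqP. Qed.

Let e_neq (x y : V) : e x y -> pos x - pos y != 0.
Proof.
move=> /eP h; apply/eqP => E; move: D0.
by rewrite -h /dist2 E dot0l ltxx.
Qed.

Lemma nbr_short_arc (x x1 x2 : V) : e x1 x -> e x2 x ->
  short_arc (pos x1 - pos x) (pos x2 - pos x).
Proof.
move=> e1 e2 a b a0 b0 E.
apply: (cone_eq0 (v := pos x1 - pos x) (eP e1) (eP e2)); rewrite ?dist2_subr ?e_neq //.
by rewrite E dot0r.
Qed.

Lemma nbr_cones_disjoint (x x1 x2 c c1 c2 : V) (s t a b : R) (eps : bool) :
  e x1 x -> e x2 x -> e c1 c -> e c2 c ->
  x != c -> x != c1 -> x1 != c -> x2 != c ->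
  0 <= s -> 0 <= t -> 0 <= a -> 0 <= b ->
  s *: (pos x1 - pos x) + t *: (pos x2 - pos x) =
    (-1) ^+ eps *: (a *: (pos c1 - pos c) + b *: (pos c2 - pos c)) ->
  s *: (pos x1 - pos x) + t *: (pos x2 - pos x) = 0.
Proof.
move=> e1 e2 f1 f2 xc xc1 x1c x2c s0 t0 a0 b0.
have npos (u v : V) : u != v -> pos u != pos v by rewrite (inj_eq pos_inj).
case: eps; last first.
  rewrite scale1r => E.
  have [|-> ->] := cones_same (eP e1) (eP e2) (eP f1) (eP f2) (pos_le _ _)
    (pos_le _ _) (pos_le _ _) (pos_le _ _) _ s0 t0 a0 b0 E.
    by rewrite npos // eq_sym.
  by rewrite !scale0r addr0.
rewrite expr1 scaleN1r opprD -!scalerN !opprB => E.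
apply: (cones_opposite (eP e1) (eP e2) _ _ _ _ _ _ _ _ _ _ s0 t0 a0 b0 E);
  rewrite ?pos_le ?npos // 1?eq_sym //.
- by rewrite dist2C eP.
- by rewrite dist2C eP.
Qed.

Lemma off_circuit_bicolorable m (c : nat -> V) : odd_circuit e m c ->
  bicolorable e (off_circuit m c).
Proof.
move=> circ; pose N := m.*2.+1.
(* The alternating signs put [P i] and [P i.+1] both in the cone at [c i.+1] or both in its
   opposite; the odd length makes the curve antipodal. *)
pose P i := (-1) ^+ i *: (pos (c i.+1) - pos (c i)).
have Pl i : P i = (-1) ^+ odd i.+1 *: (pos (c i) - pos (c i.+1)).
  by rewrite signr_odd exprS mulN1r scaleNr -scalerN opprB /P.
have Pr i : P i.+1 = (-1) ^+ odd i.+1 *: (pos (c i.+2) - pos (c i.+1)).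
  by rewrite signr_odd /P.
have edge i : e (c i) (c i.+1) by case: circ.
have edge' i : e (c i.+1) (c i) by rewrite esym.
have short i : (i < N)%N -> short_arc (P i) (P i.+1).
  move=> _ a b a0 b0; rewrite Pl Pr !scalerA !(mulrC _ ((-1) ^+ _)) -!scalerA -scalerDr.
  move=> /eqP; rewrite scaler_eq0 signr_eq0 /= => /eqP.
  exact: nbr_short_arc.
have antip : P N = - P 0%N.
  rewrite /P /N -signr_odd /= odd_double expr1 scale1r scaleN1r.
  by case: circ => _ per; rewrite -[m.*2.+2]add1n -[m.*2.+1]add0n !per.
have offP (x : V) i : x \in off_circuit m c -> x != c i by exact: (off_circuitP circ).
(* The segment between two edge directions stays in the cone at [x], which shares no non-zero vector
   with the cones at circuit vertices or their opposites. *)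
have av (x x1 x2 : V) t : x \in off_circuit m c -> x1 \in off_circuit m c ->
    x2 \in off_circuit m c -> e x1 x -> e x2 x -> 0 <= t <= 1 ->
    avoids P N (pos x1 - pos x + t *: ((pos x2 - pos x) - (pos x1 - pos x))).
  move=> ox ox1 ox2 e1 e2 /andP[t0 t1].
  have -> : pos x1 - pos x + t *: (pos x2 - pos x - (pos x1 - pos x)) =
     (1 - t) *: (pos x1 - pos x) + t *: (pos x2 - pos x).
    by rewrite scalerBr scalerBl scale1r addrCA addrC.
  have nz : (1 - t) *: (pos x1 - pos x) + t *: (pos x2 - pos x) != 0.
    apply/eqP => /(nbr_short_arc e1 e2)[]; rewrite ?subr_ge0 //; lra.
  split=> // i _ a b u a0 b0; rewrite Pl Pr !scalerA !(mulrC _ ((-1) ^+ _)).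
  rewrite -!scalerA -scalerDr => E; apply/eqP/negPn/negP => u0.
  have /negP[] : `|u| *: ((1 - t) *: (pos x1 - pos x) + t *: (pos x2 - pos x)) != 0.
    by rewrite scaler_eq0 normr_eq0 negb_or u0 nz.
  apply/eqP; rewrite scalerDr !scalerA.
  (* Having scaled by |u|, the sign of [u] is absorbed into the choice between a cone and its
     opposite. *)
  apply: (@nbr_cones_disjoint x x1 x2 (c i.+1) (c i) (c i.+2) _ _ a b
    (odd i.+1 (+) (u < 0))); rewrite ?mulr_ge0 ?subr_ge0 ?offP //.
  rewrite signr_addb [X in _ = X *: _]mulrC -[RHS]scalerA E -!scalerA -scalerDr scalerA.
  by rewrite normrEsign.
(* A vertex takes the side of the direction to one neighbour off the circuit, whichever it is; the
   default [true] concerns only vertices without such a neighbour. *)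
pose nb (x : V) := [pick y in off_circuit m c | e y x].
exists (fun x : V => if nb x is Some y then side P N (pos y - pos x) else true).
have fE (x y : V) : x \in off_circuit m c -> y \in off_circuit m c -> e y x ->
   (if nb x is Some y then side P N (pos y - pos x) else true) =
   side P N (pos y - pos x).
  move=> ox oy exy; rewrite /nb; case: pickP => [z /andP[oz ezx]|/(_ y)]; last first.
    by rewrite oy exy.
  by apply: (side_segment short) => // t; apply: av.
move=> x y ox oy exy; have eyx : e y x by rewrite esym.
rewrite (fE _ _ ox oy eyx) (fE _ _ oy ox exy).
have -> : pos x - pos y = - (pos y - pos x) by rewrite opprB.
rewrite (sideN short) //; first by case: side.
have := av _ _ _ 0 ox oy oy eyx eyx; rewrite scale0r addr0; apply.
by rewrite lexx ler01.
Qed.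

End Graph.
End Diameters.

(** * Upper bounds for diametral point sets *)

Section DiameterGraph.
Variable R : realType.
Implicit Types (S : {fset 'rV[R]_3}) (x y : 'rV[R]_3).

Lemma edistE x y : edist x y = Num.sqrt (dist2 x y).
Proof. by congr Num.sqrt; apply: eq_bigr => i _; rewrite !mxE expr2. Qed.

Lemma edist_le_diam S x y : x \in S -> y \in S -> edist x y <= diam S.
Proof.
move=> xS yS; apply: bigmax_sup_seq xS isT _.
exact: le_bigmax_seq yS isT.
Qed.

Lemma diam_eq S d x y : (forall u v, u \in S -> v \in S -> edist u v <= d) ->
  x \in S -> y \in S -> edist x y = d -> diam S = d.
Proof.
move=> ub xS yS xyd; apply/eqP; rewrite eq_le -{2}xyd edist_le_diam // andbT.
have d0 : 0 <= d by rewrite -xyd sqrtr_ge0.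
rewrite /diam big_seq; apply: bigmax_le => // u uS.
by rewrite big_seq; apply: bigmax_le => // v vS; apply: ub.
Qed.

Lemma edist_eq x y d : 0 <= d -> (edist x y == d) = (dist2 x y == d ^+ 2).
Proof.
move=> d0; rewrite edistE -(eqrXn2 (n := 2)) ?sqrtr_ge0 //.
by rewrite sqr_sqrtr // dot_ge0.
Qed.

Lemma edist_le x y d : 0 <= d -> (edist x y <= d) = (dist2 x y <= d ^+ 2).
Proof.
move=> d0; rewrite edistE -(ler_pXn2r (n := 2)) ?nnegrE ?sqrtr_ge0 //.
by rewrite sqr_sqrtr // dot_ge0.
Qed.

Lemma diametral_independent k S (A : {set S}) : diametral k S ->
  independent (@diam_graph R 3 S) A -> (#|A| < k)%N.
Proof.
move=> [_ kS] /independentP ind; rewrite ltnNge; apply/negP => kA.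
pose s := take k (enum A).
have us : uniq s by rewrite take_uniq ?enum_uniq.
have sA v : v \in s -> v \in A by move=> /mem_take; rewrite mem_enum.
have ss : size s = k by rewrite size_take -cardE; case: ltngtP kA.
pose T : {fset 'rV[R]_3} := [fset x | x in [seq val v | v <- s]]%fset.
have TP x : x \in T -> exists2 v, v \in s & x = val v.
  by rewrite inE => /mapP.
have [||x [y [/TP[u us' ->] /TP[v vs ->] xy uv]]] := kS T.
- by apply/fsubsetP => x /TP[u _ ->]; exact: valP.
- rewrite card_fseq undup_id ?size_map //; rewrite map_inj_uniq //; exact: val_inj.
have := ind u v (sA _ us') (sA _ vs); rewrite /diam_graph uv eqxx andbT.
by move=> /negP; apply; apply: contra_neq xy => ->.
Qed.

Section Fixed.
Variables (S : {fset 'rV[R]_3}).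
Hypothesis d0 : 0 < diam S.
Let D := diam S ^+ 2.
Let e := @diam_graph R 3 S.

Lemma diam_graphE (x y : S) : e x y = (dist2 (val x) (val y) == D).
Proof.
rewrite /e /diam_graph edist_eq ?ltW //; case: eqVneq => //= ->.
apply/esym/negP; rewrite (_ : dist2 _ _ = 0); last by apply/eqP; rewrite dist2_eq0.
by rewrite eq_sym sqrf_eq0 gt_eqF.
Qed.

Lemma diam_graph_sym : symmetric e.
Proof. by move=> x y; rewrite !diam_graphE dist2C. Qed.

Lemma diam_graph_irr : irreflexive e.
Proof. by move=> x; rewrite /e /diam_graph eqxx. Qed.

Lemma dist2_le_diam (x y : S) : dist2 (val x) (val y) <= D.
Proof.
rewrite -(edist_le _ _ (ltW d0)); exact: edist_le_diam (valP x) (valP y).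
Qed.

Lemma diam_graph_dolnikov m c : odd_circuit e m c -> bicolorable e (off_circuit m c).
Proof.
apply: (off_circuit_bicolorable (D := D) _ val_inj dist2_le_diam diam_graphE).
by rewrite exprn_gt0.
Qed.

Lemma diam_graph_K5 (a b c u v : S) :
  e a b -> e a c -> e b c -> e u a -> e u b -> e u c -> e v a -> e v b -> e v c ->
  u = v.
Proof.
rewrite !diam_graphE => /eqP ab /eqP ac /eqP bc /eqP ua /eqP ub /eqP uc /eqP va /eqP vb /eqP vc.
apply: val_inj; apply: (K5_minus_edge_eq _ ab ac bc ua ub uc va vb vc).
  by rewrite exprn_gt0.
exact: dist2_le_diam.
Qed.

End Fixed.

Lemma diametral_card_le k S : (3 <= k)%N -> diametral k S ->
  (#|` S| <= 3 * k - 2)%N.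
Proof.
move=> k3 kS; have d0 := kS.1; rewrite cardfE.
have -> : (3 * k - 2 = 3 * k.-1 + 1)%N by lia.
apply: (card_le_3alpha1 (diam_graph_sym d0) (@diam_graph_irr S)); first by lia.
  have k0 : (0 < k)%N by lia.
  by move=> A /(diametral_independent kS) lt; rewrite -ltnS prednK.
exact: (diam_graph_dolnikov d0).
Qed.

Lemma diametral3_card_le S : diametral 3 S -> (#|` S| <= 6)%N.
Proof.
move=> S3; have d0 := S3.1; rewrite cardfE.
apply: (card_le6 (diam_graph_sym d0) (@diam_graph_irr S)).
- by move=> A /(diametral_independent S3).
- exact: (diam_graph_dolnikov d0).
exact: (diam_graph_K5 d0).
Qed.

Lemma diametral3_one_of_eight S : diametral 3 S -> #|` S| = 6%N ->
  one_of_eight (@diam_graph R 3 S).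
Proof.
move=> S3; have d0 := S3.1; rewrite cardfE.
apply: (card6_one_of_eight (diam_graph_sym d0) (@diam_graph_irr S)).
- by move=> A /(diametral_independent S3).
- exact: (diam_graph_dolnikov d0).
exact: (diam_graph_K5 d0).
Qed.

End DiameterGraph.

(** * Point sets of size 2k *)

Section LowerBound.
Variable R : realType.

Definition vec3 (a b c : R) : 'rV[R]_3 := \row_(j < 3) [:: a; b; c]`_j.

Lemma dist2_vec3 a b c a' b' c' : dist2 (vec3 a b c) (vec3 a' b' c') =
  (a - a') ^+ 2 + (b - b') ^+ 2 + (c - c') ^+ 2.
Proof. by rewrite /dist2 dotE !mxE /= !expr2. Qed.

(** The sign vectors with product 1: a regular tetrahedron of squared edge 8 and squared
    circumradius 3. *)
Definition tetra_vertex (s t : bool) : 'rV[R]_3 :=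
  vec3 ((-1) ^+ s) ((-1) ^+ t) ((-1) ^+ (s (+) t)).

(* Any small distinct positive values would do: the direction of the i-th diameter
   must stay close to an axis joining the midpoints of two opposite edges of the
   tetrahedron. *)
Definition tilt (i : nat) : R := (20 + i%:R)^-1.

(** Antipodal points of the sphere of squared radius 2, hence again at squared distance 8. *)
Definition pair_vertex (i : nat) (b : bool) : 'rV[R]_3 :=
  vec3 ((-1) ^+ b * Num.sqrt (2 - tilt i ^+ 2)) ((-1) ^+ b * tilt i) 0.

Lemma tilt_bounds i : 0 < tilt i <= 1 / 20.
Proof.
have h : 20 <= 20 + i%:R :> R by rewrite lerDl ler0n.
have h0 : 0 < 20 + i%:R :> R by apply: lt_le_trans h.
by rewrite /tilt invr_gt0 h0 div1r lef_pV2 ?posrE.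
Qed.

Lemma tilt_inj : injective tilt.
Proof.
by move=> i j /invr_inj/addrI/eqP; rewrite eqr_nat => /eqP.
Qed.

(** The bound 3/2 keeps each pair close enough to the tetrahedron: 3 + 2 + 2 (x + t) <= 8. *)
Lemma pair_coords i : exists2 x : R, Num.sqrt (2 - tilt i ^+ 2) = x &
  [/\ 0 < x, x ^+ 2 + tilt i ^+ 2 = 2 & x + tilt i <= 3 / 2].
Proof.
have /andP[t0 t1] := tilt_bounds i; exists (Num.sqrt (2 - tilt i ^+ 2)) => //.
have t2 : 0 < 2 - tilt i ^+ 2 by nra.
have x0 : 0 < Num.sqrt (2 - tilt i ^+ 2) by rewrite sqrtr_gt0.
have x2 := sqr_sqrtr (ltW t2); move: x0 x2; move: (Num.sqrt _) => x x0 x2.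
by split=> //; [rewrite x2 subrK | nra].
Qed.

Section Configuration.
Variable m : nat.

Definition config_index : finType := ((bool * bool) + ('I_m * bool))%type.

Definition config (v : config_index) : 'rV[R]_3 :=
  match v with
  | inl (s, t) => tetra_vertex s t
  | inr (i, b) => pair_vertex i b
  end.

(** The tetrahedron and the m pairs are m + 1 cliques, so two of any m + 2 points share one. *)
Definition config_clique (v : config_index) : option 'I_m :=
  if v is inr (i, _) then Some i else None.

Lemma config_le v w : dist2 (config v) (config w) <= 8.
Proof.
have tp s t i b : dist2 (tetra_vertex s t) (pair_vertex i b) <= 8.
  rewrite /tetra_vertex /pair_vertex dist2_vec3; have [x -> [x0 x2 xy]] := pair_coords i.
  have /andP[y0 _] := tilt_bounds i; move: (tilt i) x2 xy y0 => y x2 xy y0.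
  by case: s; case: t; case: b; rewrite /= ?expr0 ?expr1; nra.
case: v w => [[s t]|[i b]] [[s' t']|[j b']] /=.
- by rewrite dist2_vec3; case: s; case: t; case: s'; case: t'; rewrite /= ?expr0 ?expr1; lra.
- exact: tp.
- by rewrite dist2C; exact: tp.
rewrite /pair_vertex dist2_vec3.
have [x -> [x0 x2 _]] := pair_coords i; have [x' -> [x'0 x'2 _]] := pair_coords j.
move: (tilt i) (tilt j) x2 x'2 => y y' x2 x'2.
have := sqr_ge0 (x - x'); have := sqr_ge0 (y - y').
have := sqr_ge0 (x + x'); have := sqr_ge0 (y + y').
by case: b; case: b'; rewrite /= ?expr0 ?expr1; nra.
Qed.

Lemma config_clique_dist v w : v != w -> config_clique v = config_clique w ->
  dist2 (config v) (config w) = 8.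
Proof.
case: v w => [[s t]|[i b]] [[s' t']|[j b']] //=.
  move=> + _; rewrite dist2_vec3.
  by case: s; case: t; case: s'; case: t' => // _; rewrite /= ?expr0 ?expr1; ring.
move=> + [ij]; rewrite -{}ij /pair_vertex dist2_vec3.
have [x -> [x0 x2 _]] := pair_coords i.
case: b; case: b'; rewrite ?eqxx // => _; rewrite /= ?expr0 ?expr1;
  move: (tilt i) x2 => y x2; by lra.
Qed.

(** The third coordinate tells the tetrahedron from the pairs, and the second one, equal to [tilt i]
    up to sign, tells the pairs apart. *)
Lemma config_inj : injective config.
Proof.
have tp s t i b : tetra_vertex s t != pair_vertex i b.
  apply/eqP => /rowP/(_ (lift ord0 (lift ord0 ord0))); rewrite !mxE /=.
  by move/eqP; rewrite signr_eq0.
move=> v w; case: (eqVneq v w) => // vw.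
have [cc|] := eqVneq (config_clique v) (config_clique w).
  have := config_clique_dist vw cc => /[swap] ->.
  move/eqP; rewrite (_ : dist2 _ _ = 0); last by apply/eqP; rewrite dist2_eq0.
  by rewrite eq_sym pnatr_eq0.
case: v w vw => [[s t]|[i b]] [[s' t']|[j b']] //= _ ij.
- by move/eqP; rewrite (negbTE (tp _ _ _ _)).
- by move/esym/eqP; rewrite (negbTE (tp _ _ _ _)).
move/rowP/(_ (lift ord0 ord0)); rewrite !mxE /=.
have /andP[yi _] := tilt_bounds i; have /andP[yj _] := tilt_bounds j.
have ne : tilt i <> tilt j by move=> /tilt_inj/ord_inj h; rewrite h eqxx in ij.
by case: b; case: b'; rewrite /= ?expr0 ?expr1 => ?; case: ne; lra.
Qed.

Definition config_set : {fset 'rV[R]_3} :=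
  [fset x | x in [seq config v | v <- enum {: config_index}]]%fset.

Lemma config_setP x : reflect (exists v, x = config v) (x \in config_set).
Proof.
rewrite inE; apply: (iffP mapP) => [[v _ ->]|[v ->]]; first by exists v.
by exists v; rewrite ?mem_enum.
Qed.

Lemma card_config_set : #|` config_set| = (2 * (m + 2))%N.
Proof.
rewrite card_fseq undup_id; last by rewrite map_inj_uniq ?enum_uniq //; exact: config_inj.
rewrite size_map -cardE card_sum !card_prod card_bool card_ord; lia.
Qed.

Lemma diam_config_set : diam config_set = Num.sqrt 8.
Proof.
have e8 := config_clique_dist (v := inl (true, true)) (w := inl (true, false)) isT erefl.
apply: (diam_eq (x := config (inl (true, true))) (y := config (inl (true, false)))).
- move=> u v /config_setP[v' ->] /config_setP[w' ->].
  by rewrite edistE ler_wsqrtr // config_le.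
- by apply/config_setP; eexists.
- by apply/config_setP; eexists.
by rewrite edistE e8.
Qed.

Lemma config_diametral : diametral (m + 2) config_set.
Proof.
split; first by rewrite diam_config_set sqrtr_gt0.
move=> T /fsubsetP sT Tk; pose J := [set v | config v \in T].
have cJ : #|J| = (m + 2)%N.
  rewrite -Tk cardE -(size_map config).
  have -> : T = [fset x | x in [seq config v | v <- enum J]]%fset.
    apply/fsetP => x; rewrite inE; apply/idP/mapP => [xT|[v]].
      have /config_setP[v xv] := sT _ xT; exists v => //.
      by rewrite mem_enum inE -xv.
    by rewrite mem_enum inE => vT ->.
  rewrite card_fseq undup_id // map_inj_uniq ?enum_uniq //; exact: config_inj.
have : ~~ [forall v in J, forall w in J, (config_clique v == config_clique w) ==> (v == w)].
  apply/negP => /forall_inP inj.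
  have : (#|config_clique @: J| <= #|{: option 'I_m}|)%N by exact: max_card.
  rewrite card_in_imset ?cJ ?card_option ?card_ord; first by lia.
  by move=> v w vJ wJ vw; apply/eqP; have /forall_inP/(_ w wJ)/implyP := inj v vJ; apply; apply/eqP.
rewrite negb_forall => /existsP[v]; rewrite negb_imply => /andP[vJ].
rewrite negb_forall => /existsP[w]; rewrite !negb_imply => /and3P[wJ /eqP cc vw].
exists (config v), (config w); split; first by rewrite inE in vJ.
- by rewrite inE in wJ.
- by rewrite (inj_eq config_inj).
by rewrite diam_config_set edistE config_clique_dist.
Qed.

End Configuration.

Lemma diametral_2k k : (2 <= k)%N ->
  exists S : {fset 'rV[R]_3}, diametral k S /\ #|` S| = (2 * k)%N.
Proof.
move=> k2; exists (config_set (k - 2)); have E : (k - 2 + 2 = k)%N by rewrite subnK.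
by rewrite card_config_set -{2}E E; split=> //; rewrite -{1}E; exact: config_diametral.
Qed.

End LowerBound.

Theorem theorem9 (R : realType) :
  (forall k : nat, (4 <= k)%N ->
     exists g : nat, is_g R 3 k g /\ (2 * k <= g <= 3 * k - 2)%N) /\
  is_g R 3 3 6 /\
  (forall S : {fset 'rV[R]_3}, diametral 3 S -> #|` S|%fset = 6%N ->
     one_of_eight (@diam_graph R 3 S)).
Proof.
split; last split.
- move=> k k4; have k3 : (3 <= k)%N by exact: ltnW.
  (* The attained cardinalities form a non-empty bounded set, whose maximum is [g]. *)
  pose Q n := boolp.asbool (exists S : {fset 'rV[R]_3}, diametral k S /\ #|` S| = n).
  have QP n : reflect (exists S : {fset 'rV[R]_3}, diametral k S /\ #|` S| = n) (Q n).
    exact: boolp.asboolP.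
  have Q2 : Q (2 * k)%N by apply/QP/diametral_2k/ltnW.
  have Qub n : Q n -> (n <= 3 * k - 2)%N.
    by move=> /QP[S [kS <-]]; exact: diametral_card_le.
  have exQ : exists n, Q n by exists (2 * k)%N.
  case: (ex_maxnP exQ Qub) => g Qg gmax.
  exists g; split; last by rewrite gmax // Qub.
  split; first exact/QP.
  by move=> S kS; apply: gmax; apply/QP; exists S.
- split; last exact: diametral3_card_le.
  exact: (@diametral_2k R 3).
exact: diametral3_one_of_eight.
Qed.
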